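(* Let $v:\mathbb{R}\to\mathbb{R}$ be a $1$-periodic, real-analytic, non-constant function. For every $q\in\mathbb{N}$ there exist $\lambda_0=\lambda_0(v,q)>0$ and a constant $C=C(v,q)<\infty$ such that the following holds: for every $\lambda>\lambda_0$, every frequency $\omega\in\mathbb{T}$, every background sequence $v_1:\mathbb{Z}\to\mathbb{R}$ taking at most $q$ distinct values, and every energy $E\in\mathbb{R}$, $$L(E)\;\ge\;\ln\lambda - C .$$ In particular, $\lambda_0$ and $C$ do not depend on $E$, $\omega$, or the background $v_1$.
   Context: We identify $\mathbb{T}=\mathbb{R}/\mathbb{Z}$ and view $v$ as a function on $\mathbb{T}$. The operator under consideration is $H=H^v_{\lambda,\omega,x}+v_1$ on $\ell^2(\mathbb{Z})$, $(Hu)(n)=u(n-1)+u(n+1)+\big(\lambda v(x+n\omega)+v_1(n)\big)u(n)$, with $x,\omega\in\mathbb{T}$, $\lambda>0$. For $N\ge 1$, $x\in\mathbb{T}$, $E\in\mathbb{R}$, define the transfer matrix $$M_N(x,E,\omega)=\prod_{k=N}^{1}\begin{pmatrix}E-\lambda v(x+k\omega)-v_1(k) & -1\\ 1 & 0\end{pmatrix}$$ (the product ordered with the factor $k=N$ on the left and $k=1$ on the right), and $$L_N(E)=\frac1N\int_{\mathbb{T}}\ln\|M_N(x,E,\omega)\|\,dx,\qquad L(E)=\liminf_{N\to\infty}L_N(E)$$ (the lower Lyapunov exponent), where $\|\cdot\|$ is the operator norm. *)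

(* Defs.v *)
From Stdlib Require Import Reals ZArith List.
From Coquelicot Require Import Coquelicot.
Open Scope R_scope.

Definition real_analytic (v : R -> R) : Prop :=
  forall x0 : R, exists (r : R) (a : nat -> R), 0 < r /\
    forall x : R, Rabs (x - x0) < r ->
      is_series (fun n => a n * (x - x0) ^ n) (v x).

Definition one_periodic (v : R -> R) : Prop := forall x, v (x + 1) = v x.

Definition non_constant (v : R -> R) : Prop := exists x y, v x <> v y.

Definition at_most_q_values (q : nat) (v1 : Z -> R) : Prop :=
  exists l : list R, (length l <= q)%nat /\ forall n, In (v1 n) l.

(* 2x2 real matrices ((a, b), (c, d)) = [[a, b], [c, d]]. *)
Definition mat2 : Type := ((R * R) * (R * R))%type.

Definition mmul (A B : mat2) : mat2 :=
  let '((a, b), (c, d)) := A in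
  let '((e, f), (g, h)) := B in
  ((a * e + b * g, a * f + b * h), (c * e + d * g, c * f + d * h)).

Definition mid : mat2 := ((1, 0), (0, 1)).

Definition opnorm (A : mat2) : R :=
  let '((a, b), (c, d)) := A in
  real (Lub_Rbar (fun r => exists u1 u2 : R,
          u1 ^ 2 + u2 ^ 2 = 1 /\
          r = sqrt ((a * u1 + b * u2) ^ 2 + (c * u1 + d * u2) ^ 2))).

Definition step (v : R -> R) (lam : R) (v1 : Z -> R) (E x om : R) (k : nat)
  : mat2 :=
  ((E - lam * v (x + INR k * om) - v1 (Z.of_nat k), -1), (1, 0)).

Fixpoint transfer (v : R -> R) (lam : R) (v1 : Z -> R) (E x om : R) (N : nat)
  : mat2 :=
  match N with
  | O => mid
  | S m => mmul (step v lam v1 E x om (S m)) (transfer v lam v1 E x om m)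
  end.

Definition LN (v : R -> R) (lam : R) (v1 : Z -> R) (om E : R) (N : nat) : R :=
  / INR N * RInt (fun x => ln (opnorm (transfer v lam v1 E x om N))) 0 1.

Definition lowerLyap (v : R -> R) (lam : R) (v1 : Z -> R) (om E : R) : Rbar :=
  LimInf_seq (fun n => LN v lam v1 om E (S n)).

(* Main.v *)
(** Write [w_k = (E - v_1(k)) / lam] and [V] for the holomorphic extension
    of [v], so that the diagonal entries of the transfer matrices are
    [lam (w_k - V(z + k om))].  For each real [w] the equation [V = w] has solutions on
    finitely many lines only, so by compactness one can find, for any [q] real values,
    a line [y = a] on which [|V - w| >= c (1 + |w|)] for all of them, with [c] depending
    only on [v] and [q].  On that line the cocycle expands by at least
    [lam c (1 + |w_k|) / 2] at step [k], while on any line of the strip it expands by at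
    most a constant times [lam (1 + |w_k|)].  The first column [(p, r)] of the transfer
    matrix never vanishes and is holomorphic, so [ln (|p|^2 + |r|^2)] is smooth and
    subharmonic, and its mean over a period is a convex function of [y].  Interpolating
    between [y = 0], [y = a] and a higher line carries the lower bound down to the real
    axis; the possibly huge terms [ln (1 + |w_k|)] occur with the same weight on both
    lines and hence do no harm. *)
Require Import Defs.
From Stdlib Require Import Reals ZArith List Lra Lia Psatz Classical ClassicalEpsilon.
From Coquelicot Require Import Coquelicot.
Open Scope R_scope.

(** * Complex power series *)

(** The bound must be uniform in [E], so the [w_k] are unbounded and compactness alone cannot supply
    [c]. Measuring the gap against [1 + |w|] repairs this: for large [|w|] it is the triangle
    inequality, and only a bounded range of [w] is left to compactness. The line [y = a] depends on
    [E], [lam] and [v1] while [c] must not, which is why each value keeps a whole band of definite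
    thickness, inside which the band of the next value is chosen.

    Let [G] be the sum of the [ln (lam (1 + |w_k|))] and [I(y)] half the mean of
    [ln (|p|^2 + |r|^2)] at height [y]. Up to constants times [N], [I(a) >= G] and [I(b) <= G].
    Convexity in the form [b I(a) <= (b - a) I(0) + a I(b)] then leaves [(b - a) G] on the side of
    [I(0)], and [2 a <= b] keeps the constants under control after division by [b - a].

    Since both entries of the column are kept, no zeros of [p] have to be counted: convexity reduces
    to the sign of a continuous function. *)

Definition CSeries (s : nat -> C) : C :=
  (Series (fun n => Re (s n)), Series (fun n => Im (s n))).

Definition summable (s : nat -> C) : Prop := ex_series (fun n => Cmod (s n)).

Lemma im_le_Cmod (z : C) : Rabs (Im z) <= Cmod z.
Proof.
  eapply Rle_trans; [apply Rmax_r | apply Rmax_Cmod].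
Qed.

Lemma ex_series_dom (a b : nat -> R) :
  (forall n, Rabs (a n) <= b n) -> ex_series b -> ex_series a.
Proof.
  intros H Hb. exact (@ex_series_le R_AbsRing R_CompleteNormedModule a b H Hb).
Qed.

Lemma ex_series_scalR (c : R) (a : nat -> R) :
  ex_series a -> ex_series (fun n => c * a n).
Proof. exact (@ex_series_scal R_AbsRing R_NormedModule c a). Qed.

Lemma summable_le (s : nat -> C) (b : nat -> R) :
  (forall n, Cmod (s n) <= b n) -> ex_series b -> summable s.
Proof.
  intros H Hb. apply ex_series_dom with (2 := Hb).
  intro n. rewrite Rabs_pos_eq; [apply H | apply Cmod_ge_0].
Qed.

Lemma summable_Re (s : nat -> C) : summable s -> ex_series (fun n => Re (s n)).
Proof. intro H. apply ex_series_dom with (2 := H). intro; apply re_le_Cmod. Qed.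

Lemma summable_Im (s : nat -> C) : summable s -> ex_series (fun n => Im (s n)).
Proof. intro H. apply ex_series_dom with (2 := H). intro; apply im_le_Cmod. Qed.

Lemma summable_plus (s t : nat -> C) :
  summable s -> summable t -> summable (fun n => s n + t n)%C.
Proof.
  intros Hs Ht.
  apply summable_le with (fun n => Cmod (s n) + Cmod (t n)).
  - intro; apply Cmod_triangle.
  - exact (@ex_series_plus R_AbsRing R_NormedModule _ _ Hs Ht).
Qed.

Lemma summable_scal (c : C) (s : nat -> C) :
  summable s -> summable (fun n => c * s n)%C.
Proof.
  intros Hs. apply summable_le with (fun n => Cmod c * Cmod (s n)).
  - intro; rewrite Cmod_mult; lra.
  - exact (ex_series_scalR (Cmod c) _ Hs).
Qed.

Lemma CSeries_ext (s t : nat -> C) : (forall n, s n = t n) -> CSeries s = CSeries t.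
Proof.
  intro H. unfold CSeries. f_equal; apply Series_ext; intro; rewrite H; reflexivity.
Qed.

Lemma CSeries_plus (s t : nat -> C) : summable s -> summable t ->
  CSeries (fun n => s n + t n)%C = (CSeries s + CSeries t)%C.
Proof.
  intros Hs Ht. unfold CSeries, Cplus; simpl. f_equal.
  - rewrite <- Series_plus; auto using summable_Re.
  - rewrite <- Series_plus; auto using summable_Im.
Qed.

Lemma CSeries_scal (c : C) (s : nat -> C) : summable s ->
  CSeries (fun n => c * s n)%C = (c * CSeries s)%C.
Proof.
  intros Hs. destruct c as [x y]. unfold CSeries, Cmult; simpl.
  pose proof (summable_Re _ Hs) as H1. pose proof (summable_Im _ Hs) as H2.
  f_equal; rewrite <- !Series_scal_l.
  - rewrite <- Series_minus by (apply ex_series_scalR; assumption).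
    apply Series_ext; intro n; destruct (s n); simpl; ring.
  - rewrite <- Series_plus by (apply ex_series_scalR; assumption).
    apply Series_ext; intro n; destruct (s n); simpl; ring.
Qed.

Lemma CSeries_minus (s t : nat -> C) : summable s -> summable t ->
  CSeries (fun n => s n - t n)%C = (CSeries s - CSeries t)%C.
Proof.
  intros Hs Ht.
  rewrite (CSeries_ext _ (fun n => s n + (-(1)) * t n)%C) by (intro; ring).
  rewrite CSeries_plus, CSeries_scal by auto using summable_scal. ring.
Qed.

Lemma CSeries_incr (s : nat -> C) : summable s ->
  CSeries s = (s O + CSeries (fun n => s (S n)))%C.
Proof.
  intros Hs. unfold CSeries, Cplus; simpl.
  f_equal; apply Series_incr_1; auto using summable_Re, summable_Im.
Qed.

Lemma summable_incr (s : nat -> C) : summable s <-> summable (fun n => s (S n)).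
Proof.
  exact (@ex_series_incr_1 R_AbsRing R_NormedModule (fun n => Cmod (s n))).
Qed.

(* With [z] the sum, [|z|^2 = Re (conj z * z)] is at most [|z|] times the sum of moduli. *)
Lemma CSeries_norm (s : nat -> C) : summable s ->
  Cmod (CSeries s) <= Series (fun n => Cmod (s n)).
Proof.
  intros Hs. set (z := CSeries s).
  assert (H : Re (Cconj z * z)%C <= Cmod z * Series (fun n => Cmod (s n))).
  { unfold z at 2. rewrite <- CSeries_scal by assumption.
    rewrite <- Series_scal_l.
    change (Series (fun n => Re (Cconj z * s n)%C) <= Series (fun n => Cmod z * Cmod (s n))).
    assert (S1 : summable (fun n => Cconj z * s n)%C) by (apply summable_scal; auto).
    eapply Rle_trans; [apply Rle_abs|].
    eapply Rle_trans; [apply Series_Rabs|].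
    - apply ex_series_dom with (2 := S1). intro n.
      rewrite Rabs_Rabsolu. apply re_le_Cmod.
    - apply Series_le.
      + intro n; split; [apply Rabs_pos|].
        eapply Rle_trans; [apply re_le_Cmod|]. rewrite Cmod_mult, Cmod_conj; lra.
      + exact (ex_series_scalR (Cmod z) _ Hs). }
  assert (E : Re (Cconj z * z)%C = Cmod z * Cmod z).
  { replace (Cmod z * Cmod z) with (Cmod z ^ 2) by ring. rewrite Cmod2_alt.
    destruct z; simpl; ring. }
  rewrite E in H.
  destruct (Rle_lt_or_eq_dec _ _ (Cmod_ge_0 z)) as [P|P].
  - apply Rmult_le_reg_l with (Cmod z); assumption.
  (* For a zero sum nothing can be cancelled, and nonnegativity of the series of moduli is left;
     zero is written as [0 * 0] so that [Series_scal_l] evaluates the zero series. *)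
  - rewrite <- P. rewrite <- (Rmult_0_l 0) at 1.
    replace (0 * 0) with (Series (fun _ : nat => 0 * 0)).
    + apply Series_le; [|assumption]. intro n. pose proof (Cmod_ge_0 (s n)). lra.
    + rewrite Series_scal_l. ring.
Qed.

Lemma CSeries_norm_le (s : nat -> C) (b : nat -> R) :
  (forall n, Cmod (s n) <= b n) -> ex_series b -> Cmod (CSeries s) <= Series b.
Proof.
  intros H Hb. pose proof (summable_le _ _ H Hb).
  eapply Rle_trans; [apply CSeries_norm; assumption|].
  apply Series_le; auto. intro n; split; [apply Cmod_ge_0 | apply H].
Qed.

(** ** Power series with geometrically bounded coefficients *)

(** Cauchy estimates on the disc of radius [/ rho], with explicit constants because shift, division
    and differentiation each act on [M] and [rho] by a simple rule. *)
Definition geo (M rho : R) (a : nat -> C) : Prop :=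
  0 <= M /\ 0 <= rho /\ forall k, Cmod (a k) <= M * rho ^ k.

Definition CP (a : nat -> C) (z : C) : C := CSeries (fun k => a k * z ^ k)%C.

Lemma CP_0 (a : nat -> C) : CP a 0 = a O.
Proof.
  assert (Z : forall n, (a (S n) * 0 ^ S n)%C = RtoC 0) by (intro; rewrite Cpow_S; ring).
  assert (S0 : summable (fun k => a k * 0 ^ k)%C).
  { apply summable_incr. apply (ex_series_ext (fun n => 0 * Cmod (a n))).
    - intro n. rewrite Z, Cmod_0. apply Rmult_0_l.
    - exists 0. apply is_series_Reals. intros eps Heps. exists O. intros n _.
      rewrite sum_eq_R0 by (intros; ring).
      unfold Rdist. rewrite Rminus_diag_eq, Rabs_R0; auto. }
  unfold CP. rewrite CSeries_incr by exact S0.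
  rewrite (CSeries_ext (fun n => a (S n) * 0 ^ S n)%C (fun n => 0 * (a n * 0 ^ n))%C).
  - rewrite CSeries_scal by exact S0. simpl. ring.
  - intro n. rewrite Z. ring.
Qed.

Lemma ex_geom (M q : R) : 0 <= q < 1 -> ex_series (fun k => M * q ^ k).
Proof.
  intro H. apply ex_series_scalR.
  apply ex_series_geom. rewrite Rabs_pos_eq; lra.
Qed.

Lemma Series_geom_scal (M q : R) : 0 <= q < 1 -> Series (fun k => M * q ^ k) = M / (1 - q).
Proof.
  intro H. rewrite Series_scal_l, Series_geom by (rewrite Rabs_pos_eq; lra). reflexivity.
Qed.

Lemma geo_term (M rho : R) (a : nat -> C) (z : C) (q : R) :
  geo M rho a -> rho * Cmod z <= q -> forall k, Cmod (a k * z ^ k)%C <= M * q ^ k.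
Proof.
  intros [HM [Hr Ha]] Hq k. rewrite Cmod_mult, Cmod_pow.
  pose proof (Cmod_ge_0 z).
  apply Rle_trans with (M * rho ^ k * Cmod z ^ k).
  - apply Rmult_le_compat_r; [apply pow_le; assumption | apply Ha].
  - rewrite Rmult_assoc, <- Rpow_mult_distr.
    apply Rmult_le_compat_l; [assumption|]. apply pow_incr. split; [|assumption].
    apply Rmult_le_pos; assumption.
Qed.

Lemma geo_summable (M rho : R) (a : nat -> C) (z : C) :
  geo M rho a -> rho * Cmod z < 1 -> summable (fun k => a k * z ^ k)%C.
Proof.
  intros H Hz. apply summable_le with (fun k => M * (rho * Cmod z) ^ k).
  - apply (geo_term M rho); auto; lra.
  - apply ex_geom. destruct H as [_ [Hr _]]. split; auto.
    apply Rmult_le_pos; [assumption | apply Cmod_ge_0].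
Qed.

(* Synthetic division by [z - z0]. *)
Definition quot (z0 : C) (a : nat -> C) (k : nat) : C :=
  CSeries (fun j => a (S k + j)%nat * z0 ^ j)%C.

Lemma geo_shift (M rho : R) (a : nat -> C) (k : nat) :
  geo M rho a -> geo (M * rho ^ k) rho (fun j => a (k + j)%nat).
Proof.
  intros [HM [Hr Ha]]. split; [|split]; auto.
  - apply Rmult_le_pos; auto using pow_le.
  - intro j. eapply Rle_trans; [apply Ha|]. rewrite pow_add. lra.
Qed.

(** Confining [z0] to half the disc makes every coefficient a geometric sum of ratio at most 1/2;
    this is the factor 2, and [rho] does not change. *)
Lemma geo_quot (M rho : R) (a : nat -> C) (z0 : C) :
  geo M rho a -> rho * Cmod z0 <= 1 / 2 -> geo (2 * M * rho) rho (quot z0 a).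
Proof.
  intros H Hz. assert (H' := H). destruct H' as [HM [Hr Ha]].
  split; [|split]; auto.
  - apply Rmult_le_pos; auto. lra.
  - intro k. unfold quot.
    pose proof (geo_shift M rho a (S k) H) as Hk.
    eapply Rle_trans.
    + apply CSeries_norm_le with (b := fun j => (M * rho ^ S k) * (1/2) ^ j).
      * apply (geo_term _ rho); assumption.
      * apply ex_geom; lra.
    + rewrite Series_geom_scal by lra. simpl. lra.
Qed.

(** Horner's recurrence, from splitting off the first term of the series. *)
Lemma quot_rec (M rho : R) (a : nat -> C) (z0 : C) (k : nat) :
  geo M rho a -> rho * Cmod z0 <= 1 / 2 ->
  quot z0 a k = (a (S k) + z0 * quot z0 a (S k))%C.
Proof.
  intros H Hz. unfold quot.
  rewrite CSeries_incr.
  2:{ eapply geo_summable; [apply geo_shift; eassumption|]; lra. }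
  rewrite <- CSeries_scal.
  2:{ eapply geo_summable; [apply geo_shift; eassumption|]; lra. }
  rewrite Nat.add_0_r. f_equal.
  - simpl. ring.
  - apply CSeries_ext. intro n. replace (S (S k) + n)%nat with (S k + S n)%nat by lia.
    simpl. ring.
Qed.

Lemma CP_factor (M rho : R) (a : nat -> C) (z0 z : C) :
  geo M rho a -> rho * Cmod z0 <= 1 / 2 -> rho * Cmod z <= 1 / 2 ->
  CP a z = (CP a z0 + (z - z0) * CP (quot z0 a) z)%C.
Proof.
  intros H Hz0 Hz.
  assert (Sb : summable (fun k => quot z0 a k * z ^ k)%C).
  { eapply geo_summable; [apply geo_quot; eassumption|]; lra. }
  assert (Sa : summable (fun k => a k * z ^ k)%C) by (eapply geo_summable; [eassumption|lra]).
  assert (Sa0 : summable (fun k => a k * z0 ^ k)%C) by (eapply geo_summable; [eassumption|lra]).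
  assert (E0 : CP a z0 = (a O + z0 * quot z0 a O)%C).
  { unfold CP. rewrite CSeries_incr by assumption. simpl Cpow. unfold quot.
    rewrite <- CSeries_scal.
    2:{ eapply geo_summable; [apply (geo_shift M rho _ 1); eassumption|]; lra. }
    f_equal; [ring|]. apply CSeries_ext. intro n. simpl. ring. }
  assert (Sz : summable (fun k => z0 * (quot z0 a k * z ^ k))%C) by (apply summable_scal, Sb).
  assert (Sz' : summable (fun k => z * (quot z0 a k * z ^ k))%C) by (apply summable_scal, Sb).
  assert (E1 : (z * CP (quot z0 a) z - z0 * CP (quot z0 a) z
     = CSeries (fun k => a (S k) * z ^ S k) - z0 * quot z0 a O)%C).
  { unfold CP. rewrite <- !CSeries_scal by assumption.
    rewrite (CSeries_incr (fun k => z0 * (quot z0 a k * z ^ k))%C) by assumption.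
    replace (CSeries (fun n => z * (quot z0 a n * z ^ n))%C) with
      (CSeries (fun k => a (S k) * z ^ S k)%C +
       CSeries (fun n => z0 * (quot z0 a (S n) * z ^ S n)))%C.
    - simpl Cpow. ring.
    - rewrite <- CSeries_plus.
      + apply CSeries_ext. intro n. rewrite (quot_rec M rho a z0 n) by assumption.
        simpl. ring.
      + apply summable_incr in Sa. exact Sa.
      + apply summable_incr in Sz. exact Sz. }
  replace ((z - z0) * CP (quot z0 a) z)%C with
    (z * CP (quot z0 a) z - z0 * CP (quot z0 a) z)%C by ring.
  rewrite E1, E0. unfold CP. rewrite CSeries_incr by assumption. simpl Cpow. ring.
Qed.

(* Dividing out one zero lowers [n] by one while the coefficient bound at most doubles. *)
Lemma zeros_finite (n : nat) : forall (M r : R) (a : nat -> C),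
  geo M 1 a -> 0 <= r <= 1 / 2 -> r * 4 ^ S n * M < Cmod (a n) ->
  exists l : list C, forall z, Cmod z <= r -> CP a z = 0 -> In z l.
Proof.
  induction n as [|n IH]; intros M r a H Hr Hn.
  - exists nil. intros z Hz Hf. exfalso.
    pose proof (Cmod_ge_0 z) as Pz. assert (H' := H). destruct H' as [HM _].
    pose proof (CP_factor M 1 a 0 z H) as F.
    rewrite Cmod_0 in F. specialize (F ltac:(lra) ltac:(lra)).
    rewrite CP_0, Hf in F.
    (* A zero in the small disc forces [a O] to have modulus at most [r * (4 * M)], against the
       hypothesis on it. *)
    assert (F' : a O = (- (z * CP (quot 0 a) z))%C).
    { replace (a O) with ((a O + (z - 0) * CP (quot 0 a) z) - z * CP (quot 0 a) z)%C by ring.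
      rewrite <- F. ring. }
    assert (B : Cmod (CP (quot 0 a) z) <= 4 * M).
    { unfold CP. eapply Rle_trans.
      - apply CSeries_norm_le with (b := fun k => (2 * M * 1) * (1/2) ^ k).
        + apply (geo_term _ 1).
          * apply geo_quot; auto. rewrite Cmod_0; lra.
          * lra.
        + apply ex_geom; lra.
      - rewrite Series_geom_scal by lra. lra. }
    rewrite F', Cmod_opp, Cmod_mult in Hn.
    pose proof (Cmod_ge_0 (CP (quot 0 a) z)).
    assert (Cmod z * Cmod (CP (quot 0 a) z) <= r * (4 * M))
      by (apply Rmult_le_compat; assumption).
    simpl in Hn. lra.
  - destruct (classic (exists z0, Cmod z0 <= r /\ CP a z0 = 0)) as [[z0 [Hz0 Hf0]]|No].
    + assert (H' := H). destruct H' as [HM [_ Ha]].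
      assert (G : geo (2 * M) 1 (quot z0 a)).
      { replace (2 * M) with (2 * M * 1) by ring. apply geo_quot; auto; lra. }
      destruct (IH (2 * M) r (quot z0 a) G Hr) as [l Hl].
      (* Division doubles [M] and costs at most [2 r M] in the distinguished coefficient; the one
         factor 4 spent per division pays for both. *)
      * rewrite (quot_rec M 1 a z0 n H) by lra.
        assert (T : Cmod (a (S n)) <= Cmod (a (S n) + z0 * quot z0 a (S n))%C
                  + Cmod (z0 * quot z0 a (S n))%C).
        { replace (a (S n)) with ((a (S n) + z0 * quot z0 a (S n)) + - (z0 * quot z0 a (S n)))%C
            at 1 by ring.
          eapply Rle_trans; [apply Cmod_triangle|]. rewrite Cmod_opp. lra. }
        assert (T2 : Cmod (z0 * quot z0 a (S n))%C <= r * (2 * M)).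
        { rewrite Cmod_mult. apply Rmult_le_compat; auto using Cmod_ge_0.
          destruct G as [_ [_ G]]. specialize (G (S n)). rewrite pow1 in G. lra. }
        assert (P4 : 1 <= 4 ^ S n) by (apply pow_R1_Rle; lra).
        assert (r * M <= r * M * 4 ^ S n).
        { rewrite <- (Rmult_1_r (r * M)) at 1. apply Rmult_le_compat_l; [|assumption].
          apply Rmult_le_pos; lra. }
        rewrite <- (tech_pow_Rmult 4 (S n)) in Hn. lra.
      * exists (z0 :: l). intros z Hz Hf.
        destruct (classic (z = z0)) as [->|D]; [left; reflexivity|right].
        apply Hl; auto.
        pose proof (CP_factor M 1 a z0 z H ltac:(lra) ltac:(lra)) as F.
        rewrite Hf, Hf0 in F.
        assert (D' : (z - z0)%C <> 0).
        { intro K. apply D. replace z with ((z - z0) + z0)%C by ring. rewrite K. ring. }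
        replace (CP (quot z0 a) z) with (/ (z - z0) * (0 + (z - z0) * CP (quot z0 a) z))%C
          by (field; exact D').
        rewrite <- F. ring.
    + exists nil. intros z Hz Hf. apply No. eauto.
Qed.

(** ** Termwise differentiation *)

Definition dps (a : nat -> C) (k : nat) : C := (INR (S k) * a (S k))%C.

Lemma INR_S_le_pow2 (k : nat) : INR (S k) <= 2 ^ k.
Proof.
  induction k as [|k IH]; [simpl; lra|].
  rewrite S_INR. simpl pow. assert (1 <= 2 ^ k) by (apply pow_R1_Rle; lra). lra.
Qed.

(** The factor [k + 1] is absorbed into the ratio through [k + 1 <= 2^k]: the bound stays geometric
    at the cost of half the radius. *)
Lemma geo_dps (M rho : R) (a : nat -> C) : geo M rho a -> geo (M * rho) (2 * rho) (dps a).
Proof.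
  intros [HM [Hr Ha]]. split; [|split].
  - apply Rmult_le_pos; auto.
  - lra.
  - intro k. unfold dps. rewrite Cmod_mult, Cmod_R, Rabs_pos_eq by apply pos_INR.
    rewrite Rpow_mult_distr.
    apply Rle_trans with (2 ^ k * (M * rho ^ S k)).
    + apply Rmult_le_compat; auto using pos_INR, Cmod_ge_0, INR_S_le_pow2.
    + simpl. lra.
Qed.

(** The truncated exponent [k - 1] is harmless at [k = 0], where [INR k] vanishes. *)
Definition taylor_err (z h : C) (k : nat) : C :=
  ((z + h) ^ k - z ^ k - h * (INR k * z ^ (k - 1)))%C.

Lemma taylor_err_S (z h : C) (k : nat) :
  taylor_err z h (S k) = ((z + h) * taylor_err z h k + h * h * (INR k * z ^ (k - 1)))%C.
Proof.
  unfold taylor_err. replace (S k - 1)%nat with k by lia.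
  rewrite S_INR, RtoC_plus. destruct k as [|k].
  - simpl. ring.
  - replace (S k - 1)%nat with k by lia. simpl Cpow. ring.
Qed.

(** Each of the two terms in [taylor_err_S] is at most a quarter of the bound at [k], so together
    they give the bound at [S k]. The radius 1/4 leaves room for the factor [INR k], which grows at
    most like a power of 2. *)
Lemma taylor_err_bound (rho : R) (z h : C) (k : nat) :
  0 <= rho -> rho * Cmod z <= 1 / 4 -> rho * Cmod (z + h)%C <= 1 / 4 ->
  rho ^ k * Cmod (taylor_err z h k) <= 16 * rho ^ 2 * Cmod h ^ 2 * (1 / 2) ^ k.
Proof.
  intros Hr Hz Hzh.
  assert (P : 0 <= rho ^ 2 * Cmod h ^ 2)
    by (apply Rmult_le_pos; apply pow_le; auto using Cmod_ge_0).
  induction k as [|k IH].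
  - unfold taylor_err. simpl.
    replace (1 - 1 - h * (0 * 1))%C with (RtoC 0) by ring. rewrite Cmod_0. simpl in P. lra.
  - rewrite taylor_err_S.
    eapply Rle_trans.
    { apply Rmult_le_compat_l; [apply pow_le; assumption|]. apply Cmod_triangle. }
    rewrite !Cmod_mult, Cmod_R, (Rabs_pos_eq (INR k)) by apply pos_INR.
    rewrite Cmod_pow, Rmult_plus_distr_l.
    assert (A : rho ^ S k * (Cmod (z + h)%C * Cmod (taylor_err z h k))
                <= 4 * rho ^ 2 * Cmod h ^ 2 * (1 / 2) ^ k).
    { replace (rho ^ S k * (Cmod (z + h)%C * Cmod (taylor_err z h k))) with
        ((rho * Cmod (z + h)%C) * (rho ^ k * Cmod (taylor_err z h k))) by (simpl; ring).
      apply Rle_trans with (1 / 4 * (16 * rho ^ 2 * Cmod h ^ 2 * (1 / 2) ^ k)); [|lra].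
      apply Rmult_le_compat; auto.
      - apply Rmult_le_pos; auto using Cmod_ge_0.
      - apply Rmult_le_pos; auto using Cmod_ge_0, pow_le. }
    assert (B : rho ^ S k * (Cmod h * Cmod h * (INR k * Cmod z ^ (k - 1)))
                <= 4 * rho ^ 2 * Cmod h ^ 2 * (1 / 2) ^ k).
    { destruct k as [|k].
      - simpl. simpl in P. lra.
      - replace (S k - 1)%nat with k by lia.
        replace (rho ^ S (S k) * (Cmod h * Cmod h * (INR (S k) * Cmod z ^ k))) with
          (rho ^ 2 * Cmod h ^ 2 * (INR (S k) * (rho * Cmod z) ^ k))
          by (rewrite Rpow_mult_distr; simpl; ring).
        replace (4 * rho ^ 2 * Cmod h ^ 2 * (1 / 2) ^ S k) with
          (rho ^ 2 * Cmod h ^ 2 * (4 * (1 / 2) ^ S k)) by ring.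
        apply Rmult_le_compat_l; [assumption|].
        apply Rle_trans with (2 ^ k * (1 / 4) ^ k).
        + apply Rmult_le_compat; auto using pos_INR, INR_S_le_pow2.
          * apply pow_le. apply Rmult_le_pos; auto using Cmod_ge_0.
          * apply pow_incr. split; auto. apply Rmult_le_pos; auto using Cmod_ge_0.
        + rewrite <- Rpow_mult_distr. replace (2 * (1 / 4)) with (1 / 2) by lra.
          simpl. assert (0 <= (1 / 2) ^ k) by (apply pow_le; lra). lra. }
    simpl pow in *. lra.
Qed.

Lemma CP_deriv (M rho : R) (a : nat -> C) (z h : C) :
  geo M rho a -> rho * Cmod z <= 1 / 4 -> rho * Cmod (z + h)%C <= 1 / 4 ->
  Cmod (CP a (z + h) - CP a z - h * CP (dps a) z)%C <= 32 * M * rho ^ 2 * Cmod h ^ 2.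
Proof.
  intros H Hz Hzh. assert (H' := H). destruct H' as [HM [Hr Ha]].
  assert (S1 : summable (fun k => a k * (z + h) ^ k)%C) by (eapply geo_summable; [eassumption|lra]).
  assert (S2 : summable (fun k => a k * z ^ k)%C) by (eapply geo_summable; [eassumption|lra]).
  assert (S3 : summable (fun k => dps a k * z ^ k)%C).
  { eapply geo_summable; [apply geo_dps; eassumption|]. lra. }
  assert (S4 : summable (fun k => INR k * a k * z ^ (k - 1))%C).
  { apply summable_incr. apply (ex_series_ext (fun k => Cmod (dps a k * z ^ k)%C)); [|exact S3].
    intro k. unfold dps. replace (S k - 1)%nat with k by lia. reflexivity. }
  assert (E : CP (dps a) z = CSeries (fun k => INR k * a k * z ^ (k - 1))%C).
  { rewrite (CSeries_incr _ S4). unfold CP, dps.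
    rewrite (CSeries_ext _ (fun n => INR (S n) * a (S n) * z ^ (S n - 1))%C).
    - simpl. ring.
    - intro k. replace (S k - 1)%nat with k by lia. reflexivity. }
  rewrite E. unfold CP. rewrite <- CSeries_scal, <- CSeries_minus, <- CSeries_minus;
    auto using summable_scal.
  2:{ unfold Cminus. apply summable_plus; auto.
      apply (ex_series_ext (fun k => Cmod (a k * z ^ k)%C)); [|exact S2].
      intro k. rewrite Cmod_opp. reflexivity. }
  eapply Rle_trans.
  - apply CSeries_norm_le with (b := fun k => (16 * M * rho ^ 2 * Cmod h ^ 2) * (1 / 2) ^ k).
    + intro k.
      replace (a k * (z + h) ^ k - a k * z ^ k - h * (INR k * a k * z ^ (k - 1)))%C
        with (a k * taylor_err z h k)%C by (unfold taylor_err; ring).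
      rewrite Cmod_mult.
      apply Rle_trans with (M * (rho ^ k * Cmod (taylor_err z h k))).
      * rewrite <- Rmult_assoc. apply Rmult_le_compat_r; auto using Cmod_ge_0.
      * replace (16 * M * rho ^ 2 * Cmod h ^ 2 * (1 / 2) ^ k) with
          (M * (16 * rho ^ 2 * Cmod h ^ 2 * (1 / 2) ^ k)) by ring.
        apply Rmult_le_compat_l; auto using taylor_err_bound.
    + apply ex_geom; lra.
  - rewrite Series_geom_scal by lra. lra.
Qed.

(** * Holomorphic functions of two real variables *)

(* The Cauchy-Riemann equations at [x + iy], with [f1] the complex derivative of [f]. *)
Definition CRd (f f1 : R -> R -> C) (x y : R) : Prop :=
  is_derive (fun t => Re (f t y)) x (Re (f1 x y)) /\
  is_derive (fun t => Im (f t y)) x (Im (f1 x y)) /\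
  is_derive (fun t => Re (f x t)) y (- Im (f1 x y)) /\
  is_derive (fun t => Im (f x t)) y (Re (f1 x y)).

Definition cont2 (f : R -> R -> C) (x y : R) : Prop :=
  continuity_2d_pt (fun u v => Re (f u v)) x y /\
  continuity_2d_pt (fun u v => Im (f u v)) x y.

Lemma is_derive_quad (g : R -> R) (x l K e : R) : 0 < e ->
  (forall h, Rabs h < e -> Rabs (g (x + h) - g x - h * l) <= K * h ^ 2) ->
  is_derive g x l.
Proof.
  intros He H. apply is_derive_Reals. intros eps Heps.
  set (d := Rmin e (eps / (Rabs K + 1))).
  pose proof (Rabs_pos K).
  assert (Hd : 0 < d).
  { apply Rmin_pos; auto. apply Rdiv_lt_0_compat; lra. }
  exists (mkposreal d Hd). simpl. intros h Hh Hlt.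
  assert (h1 : Rabs h < e) by (eapply Rlt_le_trans; [exact Hlt | apply Rmin_l]).
  assert (h2 : Rabs h < eps / (Rabs K + 1)) by (eapply Rlt_le_trans; [exact Hlt | apply Rmin_r]).
  assert (P : 0 < Rabs h) by (apply Rabs_pos_lt; auto).
  replace ((g (x + h) - g x) / h - l) with ((g (x + h) - g x - h * l) / h) by (field; auto).
  unfold Rdiv. rewrite Rabs_mult, Rabs_inv.
  apply Rmult_lt_reg_r with (Rabs h); auto.
  rewrite Rmult_assoc, Rinv_l, Rmult_1_r by lra.
  eapply Rle_lt_trans; [apply H; auto|].
  rewrite <- (pow2_abs h).
  apply Rmult_lt_compat_r with (r := Rabs K + 1) in h2; [|lra].
  unfold Rdiv in h2. rewrite Rmult_assoc, Rinv_l, Rmult_1_r in h2 by lra.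
  assert (K * Rabs h ^ 2 <= Rabs K * Rabs h ^ 2).
  { apply Rmult_le_compat_r; [apply pow2_ge_0 | apply Rle_abs]. }
  nra.
Qed.

Lemma Cmod_le_abs (h k : R) : Cmod (h, k) <= Rabs h + Rabs k.
Proof.
  replace ((h, k) : C) with (h + Ci * k)%C
    by (unfold Cplus, Cmult, Ci, RtoC; simpl; f_equal; ring).
  eapply Rle_trans; [apply Cmod_triangle|].
  rewrite Cmod_mult, Cmod_Ci, !Cmod_R. lra.
Qed.

Lemma continuity_2d_pt_abs (g : R -> R -> R) (x y K e : R) : 0 < e ->
  (forall h k, Rabs h < e -> Rabs k < e ->
     Rabs (g (x + h) (y + k) - g x y) <= K * (Rabs h + Rabs k)) ->
  continuity_2d_pt g x y.
Proof.
  intros He H eps.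
  pose proof (Rabs_pos K) as PK. pose proof (cond_pos eps) as Pe.
  set (d := Rmin e (eps / (2 * (Rabs K + 1)))).
  assert (Hd : 0 < d).
  { apply Rmin_pos; auto. apply Rdiv_lt_0_compat; lra. }
  exists (mkposreal d Hd). simpl. intros u v Hu Hv.
  assert (d1 : d <= e) by apply Rmin_l.
  assert (d2 : d <= eps / (2 * (Rabs K + 1))) by apply Rmin_r.
  replace u with (x + (u - x)) by ring. replace v with (y + (v - y)) by ring.
  eapply Rle_lt_trans; [apply H; lra|].
  apply Rmult_le_compat_r with (r := 2 * (Rabs K + 1)) in d2; [|lra].
  unfold Rdiv in d2. rewrite Rmult_assoc, Rinv_l, Rmult_1_r in d2 by lra.
  pose proof (Rabs_pos (u - x)). pose proof (Rabs_pos (v - y)).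
  assert (K * (Rabs (u - x) + Rabs (v - y)) <= Rabs K * (Rabs (u - x) + Rabs (v - y))).
  { apply Rmult_le_compat_r; [lra | apply Rle_abs]. }
  nra.
Qed.

(** A complex increment that is real or purely imaginary yields the partial derivatives in [x] and
    in [y]; a general increment yields joint continuity. *)
Lemma CRd_quad (f f1 : R -> R -> C) (x y K e : R) : 0 < e -> e <= 1 -> 0 <= K ->
  (forall h k, Rabs h < e -> Rabs k < e ->
     Cmod (f (x + h)%R (y + k)%R - f x y - (h, k) * f1 x y)%C <= K * Cmod (h, k) ^ 2) ->
  CRd f f1 x y /\ cont2 f x y.
Proof.
  intros He He1 HK H.
  assert (C0 : forall h, Cmod (h, 0) ^ 2 = h ^ 2) by (intro; rewrite Cmod2_alt; simpl; ring).
  assert (C1 : forall h, Cmod (0, h) ^ 2 = h ^ 2) by (intro; rewrite Cmod2_alt; simpl; ring).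
  assert (R0 : Rabs 0 < e) by (rewrite Rabs_R0; assumption).
  assert (Hx : forall h, Rabs h < e ->
     Cmod (f (x + h)%R y - f x y - (h, 0) * f1 x y)%C <= K * h ^ 2).
  { intros h Hh. rewrite <- C0. specialize (H h 0 Hh R0). rewrite Rplus_0_r in H. exact H. }
  assert (Hy : forall h, Rabs h < e ->
     Cmod (f x (y + h)%R - f x y - (0, h) * f1 x y)%C <= K * h ^ 2).
  { intros h Hh. rewrite <- C1. specialize (H 0 h R0 Hh). rewrite Rplus_0_r in H. exact H. }
  split; [split; [|split; [|split]] | split].
  - apply is_derive_quad with K e; auto. intros h Hh.
    eapply Rle_trans; [|apply Hx; auto]. eapply Rle_trans; [|apply re_le_Cmod].
    apply Req_le. f_equal. unfold Re, Im; simpl. ring.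
  - apply is_derive_quad with K e; auto. intros h Hh.
    eapply Rle_trans; [|apply Hx; auto]. eapply Rle_trans; [|apply im_le_Cmod].
    apply Req_le. f_equal. unfold Re, Im; simpl. ring.
  - apply is_derive_quad with K e; auto. intros h Hh.
    eapply Rle_trans; [|apply Hy; auto]. eapply Rle_trans; [|apply re_le_Cmod].
    apply Req_le. f_equal. unfold Re, Im; simpl. ring.
  - apply is_derive_quad with K e; auto. intros h Hh.
    eapply Rle_trans; [|apply Hy; auto]. eapply Rle_trans; [|apply im_le_Cmod].
    apply Req_le. f_equal. unfold Re, Im; simpl. ring.
  - apply continuity_2d_pt_abs with (K := 2 * K + Cmod (f1 x y)) (e := e); auto.
    intros h k Hh Hk.
    change (Rabs (Re (f (x + h)%R (y + k)%R - f x y)%C)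
      <= (2 * K + Cmod (f1 x y)) * (Rabs h + Rabs k)).
    eapply Rle_trans; [apply re_le_Cmod|].
    replace (f (x + h)%R (y + k)%R - f x y)%C with
      ((f (x + h)%R (y + k)%R - f x y - (h, k) * f1 x y) + (h, k) * f1 x y)%C by ring.
    eapply Rle_trans; [apply Cmod_triangle|]. rewrite Cmod_mult.
    specialize (H h k Hh Hk). pose proof (Cmod_le_abs h k). pose proof (Cmod_ge_0 (h, k)).
    pose proof (Cmod_ge_0 (f1 x y)).
    assert (Cmod (h, k) ^ 2 <= 2 * (Rabs h + Rabs k)) by nra.
    nra.
  - apply continuity_2d_pt_abs with (K := 2 * K + Cmod (f1 x y)) (e := e); auto.
    intros h k Hh Hk.
    change (Rabs (Im (f (x + h)%R (y + k)%R - f x y)%C)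
      <= (2 * K + Cmod (f1 x y)) * (Rabs h + Rabs k)).
    eapply Rle_trans; [apply im_le_Cmod|].
    replace (f (x + h)%R (y + k)%R - f x y)%C with
      ((f (x + h)%R (y + k)%R - f x y - (h, k) * f1 x y) + (h, k) * f1 x y)%C by ring.
    eapply Rle_trans; [apply Cmod_triangle|]. rewrite Cmod_mult.
    specialize (H h k Hh Hk). pose proof (Cmod_le_abs h k). pose proof (Cmod_ge_0 (h, k)).
    pose proof (Cmod_ge_0 (f1 x y)).
    assert (Cmod (h, k) ^ 2 <= 2 * (Rabs h + Rabs k)) by nra.
    nra.
Qed.

Lemma CP_holo (M rho : R) (a : nat -> C) (x0 x y : R) :
  geo M rho a -> rho * (Rabs (x - x0) + Rabs y) < 1 / 4 ->
  CRd (fun x y => CP a ((x - x0)%R, y)) (fun x y => CP (dps a) ((x - x0)%R, y)) x y /\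
  cont2 (fun x y => CP a ((x - x0)%R, y)) x y.
Proof.
  intros H Hz. assert (H' := H). destruct H' as [HM [Hr Ha]].
  (* [s] is the room left inside the disc, and [e] is chosen so that moving both coordinates by [e]
     uses at most this room. *)
  set (s := 1 / 4 - rho * (Rabs (x - x0) + Rabs y)).
  assert (Hs : 0 < s) by (unfold s; lra).
  set (e := Rmin 1 (s / (2 * (rho + 1)))).
  assert (e1 : e <= 1) by apply Rmin_l.
  assert (e2 : e <= s / (2 * (rho + 1))) by apply Rmin_r.
  assert (e0 : 0 < e) by (apply Rmin_pos; [lra | apply Rdiv_lt_0_compat; lra]).
  apply Rmult_le_compat_r with (r := 2 * (rho + 1)) in e2; [|lra].
  unfold Rdiv in e2 at 1. rewrite Rmult_assoc, Rinv_l, Rmult_1_r in e2 by lra.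
  apply CRd_quad with (K := 32 * M * rho ^ 2) (e := e); auto.
  { apply Rmult_le_pos; [lra|]. apply pow2_ge_0. }
  intros h k Hh Hk.
  replace (((x + h - x0)%R, (y + k)%R) : C) with (((x - x0)%R, y) + (h, k))%C
    by (unfold Cplus; simpl; f_equal; ring).
  pose proof (Cmod_le_abs (x - x0) y). pose proof (Cmod_le_abs h k).
  apply (CP_deriv M rho a); auto.
  - apply Rle_trans with (rho * (Rabs (x - x0) + Rabs y)); [|lra].
    apply Rmult_le_compat_l; auto.
  - pose proof (Cmod_triangle ((x - x0)%R, y) (h, k)).
    apply Rle_trans with (rho * ((Rabs (x - x0) + Rabs y) + (e + e))).
    + apply Rmult_le_compat_l; auto. lra.
    + unfold s in *. nra.
Qed.

(** ** Re-expansion about another centre *)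

(** Fubini for a lower triangular array. Row [m] is complete once the columns up to [m] are summed,
    so stopping at column [N] affects only rows beyond [N], with an error of at most twice the tail
    of [B]. *)
Lemma Series_triangle (F : nat -> nat -> R) (B : nat -> R) :
  (forall m n, (m < n)%nat -> F m n = 0) ->
  (forall m N, sum_f_R0 (fun n => Rabs (F m n)) N <= B m) -> ex_series B ->
  is_series (fun n => Series (fun m => F m n)) (Series (fun m => sum_f_R0 (F m) m)).
Proof.
  intros H0 HB EB.
  assert (Habs : forall m N, Rabs (sum_f_R0 (F m) N) <= B m).
  { intros m N. eapply Rle_trans; [|apply (HB m N)].
    apply (Rsum_abs (F m) N). }
  assert (Hcol : forall n, ex_series (fun m => F m n)).
  { intro n. apply ex_series_dom with (2 := EB). intro m.
    eapply Rle_trans; [|apply (HB m n)].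
    destruct n as [|n]; [simpl; lra|]. simpl.
    assert (0 <= sum_f_R0 (fun n => Rabs (F m n)) n) by (apply cond_pos_sum; intro; apply Rabs_pos).
    lra. }
  assert (Hpart : forall N, ex_series (fun m => sum_f_R0 (F m) N)).
  { intro N. apply ex_series_dom with (2 := EB). intro; apply Habs. }
  assert (Hdiag : ex_series (fun m => sum_f_R0 (F m) m)).
  { apply ex_series_dom with (2 := EB). intro; apply Habs. }
  assert (Hsum : forall N, sum_f_R0 (fun n => Series (fun m => F m n)) N
                 = Series (fun m => sum_f_R0 (F m) N)).
  { induction N as [|N IH]; [reflexivity|]. simpl. rewrite IH, <- Series_plus; auto. }
  assert (Hrow : forall m N, (m <= N)%nat -> sum_f_R0 (F m) N = sum_f_R0 (F m) m).
  { intros m N Hm. induction Hm as [|N Hm IH]; [reflexivity|].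
    simpl. rewrite IH, H0 by lia. ring. }
  apply is_series_Reals. intros eps Heps.
  destruct (proj1 (is_series_Reals B (Series B)) (Series_correct _ EB) (eps / 2)) as [N0 HN0]; [lra|].
  exists N0. intros N HN. unfold Rdist. rewrite Hsum.
  rewrite <- Series_minus by auto.
  rewrite (Series_incr_n_aux _ (S N)).
  2:{ intros k Hk. rewrite Hrow by lia. ring. }
  assert (EB' : ex_series (fun k => B (S N + k)%nat)).
  { apply (ex_series_incr_n B (S N)). exact EB. }
  set (u := fun k => sum_f_R0 (F (S N + k)%nat) N - sum_f_R0 (F (S N + k)%nat) (S N + k)).
  assert (Hu : forall k, Rabs (u k) <= 2 * B (S N + k)%nat).
  { intro k. unfold u, Rminus. eapply Rle_trans; [apply Rabs_triang|]. rewrite Rabs_Ropp.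
    pose proof (Habs (S N + k)%nat N). pose proof (Habs (S N + k)%nat (S N + k)%nat). lra. }
  assert (EB2 : ex_series (fun k => 2 * B (S N + k)%nat)) by (apply ex_series_scalR; exact EB').
  eapply Rle_lt_trans.
  { apply (Series_Rabs u). apply ex_series_dom with (2 := EB2).
    intro k. rewrite Rabs_Rabsolu. apply Hu. }
  eapply Rle_lt_trans.
  { apply (Series_le _ (fun k => 2 * B (S N + k)%nat)); auto. intro k; split; auto using Rabs_pos. }
  rewrite Series_scal_l.
  pose proof (Series_incr_n B (S N) ltac:(lia) EB) as T. simpl pred in T.
  specialize (HN0 N ltac:(lia)). unfold Rdist in HN0.
  apply Rabs_def2 in HN0. simpl in *. lra.
Qed.

(** * The binomial theorem for complex numbers *)

Fixpoint csum (f : nat -> C) (N : nat) : C :=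
  match N with O => f O | S n => (csum f n + f (S n))%C end.

Lemma Re_csum (f : nat -> C) (N : nat) : Re (csum f N) = sum_f_R0 (fun n => Re (f n)) N.
Proof. induction N as [|N IH]; [reflexivity|]. simpl. rewrite <- IH. reflexivity. Qed.

Lemma Im_csum (f : nat -> C) (N : nat) : Im (csum f N) = sum_f_R0 (fun n => Im (f n)) N.
Proof. induction N as [|N IH]; [reflexivity|]. simpl. rewrite <- IH. reflexivity. Qed.

Lemma csum_ext (f g : nat -> C) (N : nat) :
  (forall n, (n <= N)%nat -> f n = g n) -> csum f N = csum g N.
Proof.
  induction N as [|N IH]; intro H; simpl; [apply H; lia|].
  rewrite IH by (intros; apply H; lia). rewrite H by lia. reflexivity.
Qed.

Lemma csum_plus (f g : nat -> C) (N : nat) :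
  csum (fun n => f n + g n)%C N = (csum f N + csum g N)%C.
Proof. induction N as [|N IH]; simpl; [reflexivity|]. rewrite IH. ring. Qed.

Lemma csum_scal (c : C) (f : nat -> C) (N : nat) :
  csum (fun n => c * f n)%C N = (c * csum f N)%C.
Proof. induction N as [|N IH]; simpl; [reflexivity|]. rewrite IH. ring. Qed.

Lemma csum_last (f : nat -> C) (N : nat) : csum f (S N) = (csum f N + f (S N))%C.
Proof. reflexivity. Qed.

Lemma csum_shift (f : nat -> C) (N : nat) :
  csum f (S N) = (f O + csum (fun n => f (S n)) N)%C.
Proof. induction N as [|N IH]; simpl; [reflexivity|]. simpl in IH. rewrite IH. ring. Qed.

(** Divided powers: they turn the binomial theorem into a plain convolution whose induction needs
    only [divpow_S]. *)
Definition divpow (z : C) (n : nat) : C := (RtoC (/ INR (fact n)) * z ^ n)%C.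

Lemma divpow_S (z : C) (n : nat) : (INR (S n) * divpow z (S n) = z * divpow z n)%C.
Proof.
  unfold divpow. rewrite fact_simpl, mult_INR, Rinv_mult, RtoC_mult, Cpow_S.
  assert (E : (INR (S n) * / INR (S n))%R = 1) by (apply Rinv_r, not_0_INR; lia).
  assert (E' : (RtoC (INR (S n)) * RtoC (/ INR (S n)))%C = 1) by (rewrite <- RtoC_mult, E; reflexivity).
  transitivity (RtoC (INR (S n)) * RtoC (/ INR (S n)) * (z * (RtoC (/ INR (fact n)) * z ^ n)))%C.
  - ring.
  - rewrite E'. ring.
Qed.

Lemma divpow_plus (z w : C) (m : nat) :
  divpow (z + w) m = csum (fun n => divpow z (m - n) * divpow w n)%C m.
Proof.
  induction m as [|m IH].
  - unfold divpow. simpl. rewrite Rinv_1. ring.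
  - assert (N0 : RtoC (INR (S m)) <> 0).
    { intro K. apply RtoC_inj in K. revert K. apply not_0_INR. lia. }
    assert (E : (INR (S m) * divpow (z + w) (S m) =
       INR (S m) * csum (fun n => divpow z (S m - n) * divpow w n) (S m))%C).
    { rewrite divpow_S, IH, <- (csum_scal (INR (S m))).
      (* Writing [S m] as [(S m - n) + n] splits each term in two, and each part lowers one of the
         two exponents through [divpow_S]. *)
      rewrite (csum_ext (fun n => INR (S m) * (divpow z (S m - n) * divpow w n))%C
         (fun n => INR (S m - n) * divpow z (S m - n) * divpow w n
         + INR n * divpow w n * divpow z (S m - n))%C).
      - rewrite csum_plus, Cmult_plus_distr_r. f_equal.
        + rewrite (csum_last (fun n => INR (S m - n) * divpow z (S m - n) * divpow w n)%C).
          rewrite Nat.sub_diag.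
          rewrite <- csum_scal. replace (INR 0 * divpow z 0 * divpow w (S m))%C with (RtoC 0)
            by (simpl; ring). rewrite Cplus_0_r.
          apply csum_ext. intros n Hn. replace (S m - n)%nat with (S (m - n)) by lia.
          rewrite divpow_S. ring.
        + rewrite csum_shift. replace (INR 0 * divpow w 0 * divpow z (S m - 0))%C with (RtoC 0)
            by (simpl; ring). rewrite Cplus_0_l, <- csum_scal.
          apply csum_ext. intros n Hn. rewrite divpow_S.
          replace (S m - S n)%nat with (m - n)%nat by lia. ring.
      - intros n Hn. replace (RtoC (INR (S m))) with (RtoC (INR (S m - n)) + RtoC (INR n))%C.
        + ring.
        + rewrite <- RtoC_plus, <- plus_INR. do 2 f_equal. lia. }
    replace (divpow (z + w) (S m)) with (/ INR (S m) * (INR (S m) * divpow (z + w) (S m)))%C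
      by (field; exact N0).
    rewrite E. field. exact N0.
Qed.

Lemma Cbinomial (z w : C) (m : nat) :
  ((z + w) ^ m = csum (fun n => Binomial.C m n * z ^ (m - n) * w ^ n) m)%C.
Proof.
  pose proof (divpow_plus z w m) as H.
  assert (F : forall n, INR (fact n) <> 0) by (intro; apply INR_fact_neq_0).
  replace ((z + w) ^ m)%C with (INR (fact m) * divpow (z + w) m)%C.
  - rewrite H, <- csum_scal. apply csum_ext. intros n Hn. unfold divpow, Binomial.C, Rdiv.
    rewrite RtoC_mult, Rinv_mult, RtoC_mult. ring.
  - unfold divpow. rewrite Cmult_assoc, <- RtoC_mult, Rinv_r by apply F. ring.
Qed.

Lemma Binomial_nonneg (m n : nat) : 0 <= Binomial.C m n.
Proof.
  unfold Binomial.C. apply Rmult_le_pos; [apply pos_INR|].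
  apply Rlt_le, Rinv_0_lt_compat. apply Rmult_lt_0_compat; apply INR_fact_lt_0.
Qed.

(** Taylor coefficients at [z] of the function that [a] represents: the powers of [w] collected from
    the expansions of [(z + w)^m]. *)
Definition recenter (a : nat -> C) (z : C) (n : nat) : C :=
  CSeries (fun k => Binomial.C (n + k) n * a (n + k)%nat * z ^ k)%C.

(** One triangular array summed by columns and by rows. Absolute convergence comes from the real
    binomial theorem for [Cmod z + Cmod w], which is why the sum of the moduli must stay in the
    disc. *)
Lemma CP_recenter (M rho : R) (a : nat -> C) (z w : C) :
  geo M rho a -> rho * (Cmod z + Cmod w) < 1 ->
  CP (recenter a z) w = CP a (z + w)%C.
Proof.
  intros H Hz. assert (H' := H). destruct H' as [HM [Hr Ha]].
  set (F := fun m n : nat => if (n <=? m)%nat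
       then (a m * (Binomial.C m n * z ^ (m - n) * w ^ n))%C else RtoC 0).
  set (B := fun m => M * (rho * (Cmod z + Cmod w)) ^ m).
  assert (EB : ex_series B).
  { apply ex_geom. split; auto. apply Rmult_le_pos; auto.
    pose proof (Cmod_ge_0 z); pose proof (Cmod_ge_0 w); lra. }
  assert (F0 : forall m n, (m < n)%nat -> F m n = 0).
  { intros m n Hmn. unfold F. replace (n <=? m)%nat with false; auto.
    symmetry. apply Nat.leb_gt. assumption. }
  assert (Fle : forall m n, (n <= m)%nat -> F m n = (a m * (Binomial.C m n * z ^ (m - n) * w ^ n))%C).
  { intros m n Hmn. unfold F. replace (n <=? m)%nat with true; auto.
    symmetry. apply Nat.leb_le. assumption. }
  assert (Fsum : forall m N, sum_f_R0 (fun n => Cmod (F m n)) N <= B m).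
  { intros m N.
    assert (Q : sum_f_R0 (fun n => Cmod (F m n)) m <= B m).
    { rewrite (sum_eq _ (fun n => Binomial.C m n * Cmod w ^ n * Cmod z ^ (m - n) * Cmod (a m)) m).
      - rewrite <- scal_sum, <- binomial. unfold B.
        rewrite Rpow_mult_distr, (Rplus_comm (Cmod w)), <- Rmult_assoc.
        apply Rmult_le_compat_r; [|apply Ha].
        apply pow_le. pose proof (Cmod_ge_0 z); pose proof (Cmod_ge_0 w); lra.
      - intros n Hn. rewrite Fle by lia.
        rewrite !Cmod_mult, !Cmod_pow, Cmod_R, Rabs_pos_eq by apply Binomial_nonneg. ring. }
    destruct (le_lt_dec m N) as [L|L].
    - apply Rle_trans with (2 := Q). apply Req_le.
      induction L as [|N L IH]; [reflexivity|]. simpl. rewrite IH, F0, Cmod_0 by lia. ring.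
    - apply Rle_trans with (2 := Q).
      assert (G : forall k, sum_f_R0 (fun n => Cmod (F m n)) N
         <= sum_f_R0 (fun n => Cmod (F m n)) (N + k)).
      { induction k as [|k IH]; [rewrite Nat.add_0_r; lra|].
        rewrite Nat.add_succ_r. simpl. pose proof (Cmod_ge_0 (F m (S (N + k)))). lra. }
      pose proof (G (m - N)%nat) as G'. replace (N + (m - N))%nat with m in G' by lia. exact G'. }
  assert (Row : forall m, csum (F m) m = (a m * (z + w) ^ m)%C).
  { intro m. rewrite Cbinomial, <- csum_scal. apply csum_ext. intros n Hn. apply Fle; lia. }
  assert (Col : forall n, CSeries (fun m => F m n) = (recenter a z n * w ^ n)%C).
  { intro n.
    assert (Sh : CSeries (fun m => F m n) = CSeries (fun k => F (n + k)%nat n)).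
    { unfold CSeries. f_equal;
        [apply (Series_incr_n_aux (fun m => Re (F m n)) n)
        |apply (Series_incr_n_aux (fun m => Im (F m n)) n)]; intros k Hk; rewrite F0 by lia; reflexivity. }
    assert (SC : summable (fun m => F m n)).
    { apply summable_le with B; auto. intro m. eapply Rle_trans; [|apply (Fsum m n)].
      destruct n as [|n]; [simpl; lra|]. simpl.
      assert (0 <= sum_f_R0 (fun n => Cmod (F m n)) n)
        by (apply cond_pos_sum; intro; apply Cmod_ge_0). lra. }
    (* Summability is known for the array, and reaches the series of [recenter] by dividing the
       column by [w ^ n]; hence [w = 0] is separate. *)
    destruct (Ceq_dec w 0) as [W0|W0].
    - destruct n as [|n].
      + rewrite Sh. unfold recenter. simpl Cpow. rewrite Cmult_1_r. apply CSeries_ext.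
        intro k. simpl Nat.add. rewrite Fle by lia. rewrite Nat.sub_0_r. simpl Cpow. ring.
      + rewrite Sh, W0. rewrite (CSeries_ext _ (fun _ => RtoC 0)).
        * rewrite Cpow_S. rewrite Cmult_0_l, Cmult_0_r. unfold CSeries. simpl.
          rewrite (Series_ext _ (fun n => 0 * 0)) by (intro; ring). rewrite Series_scal_l.
          unfold RtoC. f_equal; ring.
        * intro k. rewrite Fle by lia. rewrite W0, Cpow_S. ring.
    - assert (Wn : (w ^ n)%C <> 0) by (apply Cpow_nz; assumption).
      assert (SC' : summable (fun k => F (n + k)%nat n)).
      { apply (ex_series_incr_n (fun m => Cmod (F m n)) n). exact SC. }
      rewrite Sh. unfold recenter.
      rewrite (CSeries_ext (fun k => Binomial.C (n + k) n * a (n + k)%nat * z ^ k)%C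
         (fun k => / w ^ n * F (n + k)%nat n)%C).
      + rewrite CSeries_scal by assumption. field. assumption.
      + intro k. rewrite Fle by lia. replace (n + k - n)%nat with k by lia. field. assumption. }
  assert (HRe := Series_triangle (fun m n => Re (F m n)) B).
  assert (HIm := Series_triangle (fun m n => Im (F m n)) B).
  unfold CP. rewrite <- (CSeries_ext _ _ Col), <- (CSeries_ext _ _ Row).
  unfold CSeries at 1 3. f_equal.
  - apply is_series_unique.
    rewrite (Series_ext _ (fun m => sum_f_R0 (fun n => Re (F m n)) m)) by (intro; apply Re_csum).
    apply HRe; auto.
    + intros m n Hmn. rewrite F0 by assumption. reflexivity.
    + intros m N. eapply Rle_trans; [|apply (Fsum m N)]. apply sum_Rle. intros; apply re_le_Cmod.
  - apply is_series_unique.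
    rewrite (Series_ext _ (fun m => sum_f_R0 (fun n => Im (F m n)) m)) by (intro; apply Im_csum).
    apply HIm; auto.
    + intros m n Hmn. rewrite F0 by assumption. reflexivity.
    + intros m N. eapply Rle_trans; [|apply (Fsum m N)]. apply sum_Rle. intros; apply im_le_Cmod.
Qed.

(** * The holomorphic extension of [v] to a strip *)

Lemma CSeries_scalR (c : R) (s : nat -> C) : CSeries (fun n => c * s n)%C = (c * CSeries s)%C.
Proof.
  unfold CSeries. rewrite (Series_ext (fun n => Re (c * s n)%C) (fun n => c * Re (s n))).
  2:{ intro n. destruct (s n). simpl. ring. }
  rewrite (Series_ext (fun n => Im (c * s n)%C) (fun n => c * Im (s n))).
  2:{ intro n. destruct (s n). simpl. ring. }
  rewrite !Series_scal_l. unfold Cmult; simpl. f_equal; ring.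
Qed.

Lemma CSeries_RtoC (s : nat -> R) : CSeries (fun n => RtoC (s n)) = RtoC (Series s).
Proof.
  unfold CSeries, RtoC; simpl. f_equal.
  rewrite (Series_ext _ (fun n => 0 * 0)) by (intro; ring). rewrite Series_scal_l. ring.
Qed.

(** Real factors leave [CSeries] unconditionally, so no convergence enters; what remains is
    [(n+1) C(n+k+1, n+1) = (n+k+1) C(n+k, n)]. *)
Lemma dps_recenter (a : nat -> C) (z : C) (n : nat) :
  dps (recenter a z) n = recenter (dps a) z n.
Proof.
  unfold dps at 1, recenter. rewrite <- CSeries_scalR. apply CSeries_ext. intro k.
  unfold dps. simpl Nat.add.
  assert (E : INR (S n) * Binomial.C (S (n + k)) (S n) = Binomial.C (n + k) n * INR (S (n + k))).
  { unfold Binomial.C. replace (S (n + k) - S n)%nat with k by lia.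
    replace (n + k - n)%nat with k by lia. rewrite !fact_simpl, !mult_INR.
    field. repeat split; try apply INR_fact_neq_0; apply not_0_INR; lia. }
  replace (INR (S n) * (Binomial.C (S (n + k)) (S n) * a (S (n + k)) * z ^ k))%C with
    (RtoC (INR (S n) * Binomial.C (S (n + k)) (S n))%R * a (S (n + k)) * z ^ k)%C
    by (rewrite RtoC_mult; ring).
  rewrite E, RtoC_mult. ring.
Qed.

Lemma dps_ext (a b : nat -> C) : (forall n, a n = b n) -> forall n, dps a n = dps b n.
Proof. intros H n. unfold dps. rewrite H. reflexivity. Qed.

Lemma CP_ext (a b : nat -> C) (z : C) : (forall n, a n = b n) -> CP a z = CP b z.
Proof. intro H. unfold CP. apply CSeries_ext. intro; rewrite H; reflexivity. Qed.

Definition taylor (v : R -> R) (x : R) (n : nat) : C := RtoC (Derive_n v n x / INR (fact n)).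

(* [V(x + iy)] is the Taylor series of [v] at the real point [x], evaluated at [iy];
   periodicity in [x] is then immediate. [ext1] and [ext2] are its complex derivatives. *)
Definition ext (v : R -> R) (x y : R) : C := CP (taylor v x) (0, y).
Definition ext1 (v : R -> R) (x y : R) : C := CP (dps (taylor v x)) (0, y).
Definition ext2 (v : R -> R) (x y : R) : C := CP (dps (dps (taylor v x))) (0, y).

(** Links the Taylor series at all points near [x0] to one power series. As [ext] uses a different
    series on each vertical line, this is what makes it holomorphic in [x + iy] jointly. *)
Definition expansion (v : R -> R) (x0 rho : R) (a : nat -> C) : Prop :=
  forall x, rho * Rabs (x - x0) < 1 / 2 -> forall n, taylor v x n = recenter a (RtoC (x - x0)) n.

Lemma analytic_expansion (v : R -> R) (x0 : R) : real_analytic v ->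
  exists (M rho : R) (a : nat -> C), geo M rho a /\ 0 < rho /\ expansion v x0 rho a.
Proof.
  intro Hv. destruct (Hv x0) as [r [a [Hr Ha]]].
  (* Convergence at distance [r / 2] bounds the terms [a n * s ^ n]; their bound is [M], and [rho]
     is [/ s]. *)
  set (s := r / 2).
  assert (Hs : 0 < s) by (unfold s; lra).
  assert (Es : ex_series (fun n => a n * s ^ n)).
  { exists (v (x0 + s)). specialize (Ha (x0 + s)).
    replace (x0 + s - x0) with s in Ha by ring.
    apply Ha. rewrite Rabs_pos_eq; unfold s; lra. }
  assert (Bd : exists M, forall n, Rabs (a n * s ^ n) <= M).
  { destruct (filterlim_bounded (K := R_AbsRing) (V := R_NormedModule) (fun n => a n * s ^ n)) as [M HM].
    - exists 0. apply (ex_series_lim_0 _ Es).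
    - exists M. exact HM. }
  destruct Bd as [M HM].
  assert (CV : Rbar_le s (CV_radius a)).
  { apply (proj1 (CV_radius_bounded a)). exists M. exact HM. }
  exists M, (/ s), (fun n => RtoC (a n)).
  assert (Hr0 : 0 < / s) by (apply Rinv_0_lt_compat; assumption).
  split; [split; [|split]|split]; auto.
  - eapply Rle_trans; [apply Rabs_pos | apply (HM O)].
  - lra.
  - intro k. rewrite Cmod_R. specialize (HM k). rewrite Rabs_mult, (Rabs_pos_eq (s ^ k)) in HM
      by (apply pow_le; lra).
    assert (P : 0 < s ^ k) by (apply pow_lt; assumption).
    rewrite pow_inv. apply Rmult_le_reg_r with (s ^ k); auto.
    rewrite Rmult_assoc, Rinv_l, Rmult_1_r by lra. exact HM.
  - intros x Hx n.
    assert (Hxs : Rabs (x - x0) < s).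
    { apply Rmult_lt_compat_l with (r := s) in Hx; auto.
      rewrite <- Rmult_assoc, Rinv_r, Rmult_1_l in Hx by lra. lra. }
    assert (D : Derive_n v n x = PSeries (PS_derive_n n a) (x - x0)).
    { rewrite <- Derive_n_PSeries.
      - replace (x - x0) with (x + - x0) by ring. rewrite <- Derive_n_comp_trans.
        apply Derive_n_ext_loc.
        assert (P : 0 < s - Rabs (x - x0)) by lra.
        exists (mkposreal _ P). intros t Ht.
        assert (Ht' : Rabs (t - x) < s - Rabs (x - x0)) by exact Ht.
        symmetry. apply is_series_unique. apply Ha.
        replace (t - x0) with ((t - x) + (x - x0)) by ring.
        pose proof (Rabs_triang (t - x) (x - x0)). unfold s in *. lra.
      - eapply Rbar_lt_le_trans; [|exact CV]. exact Hxs. }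
    unfold taylor, recenter.
    rewrite (CSeries_ext _ (fun k => RtoC (Binomial.C (n + k) n * a (n + k)%nat * (x - x0) ^ k))).
    2:{ intro k. rewrite !RtoC_mult, RtoC_pow. reflexivity. }
    rewrite CSeries_RtoC. f_equal. rewrite D. unfold PSeries, Rdiv.
    rewrite Rmult_comm, <- Series_scal_l. apply Series_ext. intro k.
    unfold PS_derive_n, Binomial.C. rewrite (Nat.add_comm k n).
    replace (n + k - n)%nat with k by lia. field.
    split; apply INR_fact_neq_0.
Qed.

Lemma Cmod_imag (y : R) : Cmod (0, y) = Rabs y.
Proof.
  unfold Cmod; simpl. rewrite <- sqrt_Rsqr_abs. f_equal. unfold Rsqr. ring.
Qed.

Lemma CP_taylor_local (v : R -> R) (M rho x0 x y : R) (a b : nat -> C) :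
  geo M rho a -> (forall n, b n = recenter a (RtoC (x - x0)) n) ->
  rho * (Rabs (x - x0) + Rabs y) < 1 -> CP b (0, y) = CP a ((x - x0)%R, y).
Proof.
  intros Ha Hb Hz. rewrite (CP_ext _ _ _ Hb).
  rewrite (CP_recenter M rho); auto.
  - f_equal. unfold RtoC, Cplus; simpl. f_equal; ring.
  - rewrite Cmod_R, Cmod_imag. exact Hz.
Qed.

(** Each differentiation doubles [rho], hence the stronger condition on the point for [ext2]. *)
Lemma ext_local (v : R -> R) (M rho x0 x y : R) (a : nat -> C) :
  geo M rho a -> expansion v x0 rho a -> rho * (Rabs (x - x0) + Rabs y) < 1 / 4 ->
  ext v x y = CP a ((x - x0)%R, y) /\ ext1 v x y = CP (dps a) ((x - x0)%R, y) /\
  (4 * rho * (Rabs (x - x0) + Rabs y) < 1 -> ext2 v x y = CP (dps (dps a)) ((x - x0)%R, y)).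
Proof.
  intros Ha He Hz. assert (H' := Ha). destruct H' as [HM [Hr _]].
  assert (Hx : rho * Rabs (x - x0) < 1 / 2).
  { pose proof (Rabs_pos y). pose proof (Rabs_pos (x - x0)). nra. }
  specialize (He x Hx).
  assert (He1 : forall n, dps (taylor v x) n = recenter (dps a) (RtoC (x - x0)) n).
  { intro n. rewrite (dps_ext _ _ He). apply dps_recenter. }
  assert (He2 : forall n, dps (dps (taylor v x)) n = recenter (dps (dps a)) (RtoC (x - x0)) n).
  { intro n. rewrite (dps_ext _ _ He1). apply dps_recenter. }
  pose proof (geo_dps _ _ _ Ha) as Ha1. pose proof (geo_dps _ _ _ Ha1) as Ha2.
  split; [|split].
  - apply (CP_taylor_local v M rho); auto. lra.
  - apply (CP_taylor_local v _ _ x0 x y _ _ Ha1 He1). lra.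
  - intro. apply (CP_taylor_local v _ _ x0 x y _ _ Ha2 He2). lra.
Qed.

(** * Holomorphy of the extension *)

Lemma CRd_ext_loc (f f1 g g1 : R -> R -> C) (x y e : R) : 0 < e ->
  (forall u w, Rabs (u - x) < e -> Rabs (w - y) < e -> f u w = g u w) ->
  f1 x y = g1 x y -> CRd f f1 x y -> CRd g g1 x y.
Proof.
  intros He H H1 [A [B [C D]]].
  assert (R0 : forall t, Rabs (t - t) < e) by (intro; rewrite Rminus_diag_eq, Rabs_R0; auto).
  unfold CRd. rewrite <- H1.
  split; [|split; [|split]]; (eapply is_derive_ext_loc; [|eassumption]);
    exists (mkposreal e He); intros t Ht; simpl; rewrite H; auto.
Qed.

Lemma cont2_ext_loc (f g : R -> R -> C) (x y e : R) : 0 < e ->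
  (forall u w, Rabs (u - x) < e -> Rabs (w - y) < e -> f u w = g u w) ->
  cont2 f x y -> cont2 g x y.
Proof.
  intros He H [A B].
  split; [eapply continuity_2d_pt_ext_loc; [|exact A] | eapply continuity_2d_pt_ext_loc; [|exact B]];
    exists (mkposreal e He); intros u w Hu Hw; simpl in *; rewrite H; auto.
Qed.

(** Two complex derivatives with joint continuity up to order two: the regularity that
    differentiating a mean twice under the integral calls for. *)
Definition holo_at (f f1 f2 : R -> R -> C) (x y : R) : Prop :=
  (CRd f f1 x y /\ cont2 f x y) /\ (CRd f1 f2 x y /\ cont2 f1 x y) /\ cont2 f2 x y.

(** The factor 16: the second derivative has ratio [4 * rho], and [CP_holo] works within a quarter
    of the radius. *)
Lemma ext_holo_local (v : R -> R) (M rho x0 x y : R) (a : nat -> C) :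
  geo M rho a -> expansion v x0 rho a -> 16 * rho * (Rabs (x - x0) + Rabs y) < 1 ->
  holo_at (ext v) (ext1 v) (ext2 v) x y.
Proof.
  intros Ha He Hz. assert (H' := Ha). destruct H' as [HM [Hr _]].
  pose proof (geo_dps _ _ _ Ha) as Ha1. pose proof (geo_dps _ _ _ Ha1) as Ha2.
  set (s := 1 - 16 * rho * (Rabs (x - x0) + Rabs y)).
  assert (Hs : 0 < s) by (unfold s; lra).
  set (e := s / (32 * (rho + 1))).
  assert (e0 : 0 < e) by (apply Rdiv_lt_0_compat; lra).
  assert (e2 : e * (32 * (rho + 1)) = s) by (unfold e; field; lra).
  assert (Near : forall u w, Rabs (u - x) < e -> Rabs (w - y) < e ->
     16 * rho * (Rabs (u - x0) + Rabs w) < 1).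
  { intros u w Hu Hw. replace (u - x0) with ((u - x) + (x - x0)) by ring.
    replace w with ((w - y) + y) by ring.
    pose proof (Rabs_triang (u - x) (x - x0)). pose proof (Rabs_triang (w - y) y).
    apply Rle_lt_trans with (16 * rho * ((e + Rabs (x - x0)) + (e + Rabs y))).
    - apply Rmult_le_compat_l; lra.
    - unfold s in e2. nra. }
  assert (Loc : forall u w, Rabs (u - x) < e -> Rabs (w - y) < e ->
     ext v u w = CP a ((u - x0)%R, w) /\ ext1 v u w = CP (dps a) ((u - x0)%R, w) /\
     ext2 v u w = CP (dps (dps a)) ((u - x0)%R, w)).
  { intros u w Hu Hw. specialize (Near u w Hu Hw).
    assert (N4 : rho * (Rabs (u - x0) + Rabs w) < 1 / 4) by lra.
    destruct (ext_local v M rho x0 u w a Ha He N4) as [L0 [L1 L2]].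
    split; [|split]; auto. apply L2. lra. }
  assert (R0 : forall t, Rabs (t - t) < e) by (intro; rewrite Rminus_diag_eq, Rabs_R0; auto).
  destruct (Loc x y (R0 x) (R0 y)) as [_ [E1 E2]].
  destruct (CP_holo M rho a x0 x y Ha ltac:(lra)) as [A0 B0].
  destruct (CP_holo _ _ _ x0 x y Ha1 ltac:(lra)) as [A1 B1].
  destruct (CP_holo _ _ _ x0 x y Ha2 ltac:(lra)) as [_ B2].
  split; [split|split; [split|]].
  - eapply CRd_ext_loc; [exact e0| | |exact A0]; [|symmetry; exact E1].
    intros u w Hu Hw. symmetry. apply (Loc u w Hu Hw).
  - eapply cont2_ext_loc; [exact e0| |exact B0].
    intros u w Hu Hw. symmetry. apply (Loc u w Hu Hw).
  - eapply CRd_ext_loc; [exact e0| | |exact A1]; [|symmetry; exact E2].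
    intros u w Hu Hw. symmetry. apply (Loc u w Hu Hw).
  - eapply cont2_ext_loc; [exact e0| |exact B1].
    intros u w Hu Hw. symmetry. apply (Loc u w Hu Hw).
  - eapply cont2_ext_loc; [exact e0| |exact B2].
    intros u w Hu Hw. symmetry. apply (Loc u w Hu Hw).
Qed.

Lemma ext_real (v : R -> R) (x : R) : ext v x 0 = RtoC (v x).
Proof.
  unfold ext. change ((0, 0) : C) with (RtoC 0). rewrite CP_0. unfold taylor. simpl.
  f_equal. field.
Qed.

(** ** Level sets *)

(** The radius must not depend on [w]. If [Cmod w <= 2 * M], subtracting [w] from the constant term
    at most triples the coefficient bound and leaves the coefficient of index [S n] untouched, so
    [zeros_finite] applies with fixed constants; for larger [w] there is no solution, the series
    being at most [2 * M]. *)
Lemma CP_level_finite (M rho : R) (a : nat -> C) (n : nat) :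
  geo M rho a -> 0 < rho -> a (S n) <> 0 ->
  exists r, 0 < r /\ forall w, exists l : list C,
    forall z, Cmod z <= r -> CP a z = w -> In z l.
Proof.
  intros [HM [Hr Ha]] Hrho Hn.
  (* Rescaling the variable by [rho] reduces to ratio 1, as in [zeros_finite]. *)
  set (b := fun k => (a k * RtoC ((/ rho) ^ k))%C).
  assert (Hb : forall k, Cmod (b k) <= M).
  { intro k. unfold b. rewrite Cmod_mult, Cmod_R, Rabs_pos_eq
      by (apply pow_le; left; apply Rinv_0_lt_compat; assumption).
    apply Rle_trans with (M * rho ^ k * (/ rho) ^ k).
    - apply Rmult_le_compat_r; auto. apply pow_le; left; apply Rinv_0_lt_compat; assumption.
    - rewrite Rmult_assoc, <- Rpow_mult_distr, Rinv_r, pow1 by lra. lra. }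
  assert (Eb : forall z, CP a z = CP b (rho * z)%C).
  { intro z. unfold CP. apply CSeries_ext. intro k. unfold b.
    rewrite Cpow_mult_l, <- RtoC_pow.
    replace (a k * RtoC ((/ rho) ^ k) * (RtoC (rho ^ k) * z ^ k))%C with
      (a k * z ^ k * (RtoC ((/ rho) ^ k) * RtoC (rho ^ k)))%C by ring.
    rewrite <- RtoC_mult, <- Rpow_mult_distr, Rinv_l, pow1 by lra. ring. }
  assert (Pn : 0 < Cmod (b (S n))).
  { unfold b. rewrite Cmod_mult, Cmod_R. apply Rmult_lt_0_compat.
    - apply Cmod_gt_0. assumption.
    - apply Rabs_pos_lt. apply pow_nonzero. apply Rinv_neq_0_compat. lra. }
  (* The threshold of [zeros_finite] for the bound [3 * M]; the summand 1 and the factor 2 in [r]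
     make the inequality strict. *)
  set (K := 4 ^ S (S n) * (3 * M + 1)).
  assert (PK : 0 < K) by (apply Rmult_lt_0_compat; [apply pow_lt; lra | lra]).
  set (r := Rmin (1 / 2) (Cmod (b (S n)) / (2 * K))).
  assert (r0 : 0 < r) by (apply Rmin_pos; [lra | apply Rdiv_lt_0_compat; lra]).
  assert (r1 : r <= 1 / 2) by apply Rmin_l.
  assert (r2 : r * (2 * K) <= Cmod (b (S n))).
  { apply Rle_trans with (Cmod (b (S n)) / (2 * K) * (2 * K)).
    - apply Rmult_le_compat_r; [lra | apply Rmin_r].
    - right. field. lra. }
  exists (r / rho). split; [apply Rdiv_lt_0_compat; assumption|].
  assert (Scale : forall z, Cmod z <= r / rho -> Cmod (rho * z)%C <= r).
  { intros z Hz. rewrite Cmod_mult, Cmod_R, Rabs_pos_eq by lra.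
    apply Rmult_le_compat_l with (r := rho) in Hz; [|lra].
    replace (rho * (r / rho)) with r in Hz by (field; lra). exact Hz. }
  intro w.
  assert (Gb : geo M 1 b).
  { split; [|split]; auto; try lra. intro k. rewrite pow1, Rmult_1_r. apply Hb. }
  destruct (Rle_lt_dec (Cmod w) (2 * M)) as [Hw|Hw].
  - set (c := fun k => match k with O => (b O - w)%C | _ => b k end).
    assert (Gc : geo (3 * M) 1 c).
    { split; [|split]; try lra. intro k. rewrite pow1, Rmult_1_r. destruct k as [|k]; simpl.
      - unfold Cminus. eapply Rle_trans; [apply Cmod_triangle|]. rewrite Cmod_opp.
        specialize (Hb O). lra.
      - specialize (Hb (S k)). lra. }
    assert (Ec : forall z, Cmod z <= 1 / 2 -> CP c z = (CP b z - w)%C).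
    { intros z Hz. unfold CP. rewrite CSeries_incr, (CSeries_incr (fun k => b k * z ^ k)%C).
      - simpl. ring.
      - eapply geo_summable; [exact Gb | lra].
      - eapply geo_summable; [exact Gc | lra]. }
    destruct (zeros_finite (S n) (3 * M) r c Gc) as [l Hl].
    + lra.
    + unfold c. apply Rlt_le_trans with (2 := r2). unfold K.
      set (q := r * 4 ^ S (S n)).
      assert (0 < q) by (apply Rmult_lt_0_compat; [|apply pow_lt]; lra).
      assert (0 <= q * M) by (apply Rmult_le_pos; lra).
      replace (r * (2 * (4 ^ S (S n) * (3 * M + 1)))) with (6 * (q * M) + 2 * q)
        by (unfold q; ring). lra.
    + exists (map (fun z => / rho * z)%C l). intros z Hz Hf.
      replace z with (/ rho * (rho * z))%C.
      * apply in_map. apply Hl; auto. rewrite Ec.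
        -- rewrite <- Eb, Hf. ring.
        -- specialize (Scale z Hz). lra.
      * field. intro Q. apply RtoC_inj in Q. lra.
  - exists nil. intros z Hz Hf. exfalso. specialize (Scale z Hz).
    rewrite Eb in Hf. apply (Rlt_irrefl (2 * M)). eapply Rlt_le_trans; [exact Hw|].
    rewrite <- Hf. unfold CP. eapply Rle_trans.
    + apply CSeries_norm_le with (b := fun k => M * (1 / 2) ^ k).
      * apply (geo_term M 1); auto. lra.
      * apply ex_geom; lra.
    + rewrite Series_geom_scal by lra. lra.
Qed.

Lemma avoid_list (l : list R) : forall a b, a < b ->
  exists a' b', a <= a' /\ a' < b' /\ b' <= b /\ forall y, a' <= y <= b' -> ~ In y l.
Proof.
  induction l as [|t l IH]; intros a b Hab.
  - exists a, b. repeat split; try lra. intros y _ [].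
  - destruct (IH a b Hab) as [a1 [b1 [H1 [H2 [H3 H4]]]]].
    destruct (Rle_lt_dec t ((a1 + b1) / 2)) as [Ht|Ht].
    + exists ((a1 + 2 * b1) / 3), b1. repeat split; try lra.
      intros y Hy [E|E]; [lra|]. apply (H4 y); auto. lra.
    + exists a1, ((2 * a1 + b1) / 3). repeat split; try lra.
      intros y Hy [E|E]; [lra|]. apply (H4 y); auto. lra.
Qed.

(** * The identity principle on the real line *)

Lemma real_local (v : R -> R) (M rho x0 x : R) (a : nat -> C) :
  geo M rho a -> expansion v x0 rho a -> rho * Rabs (x - x0) < 1 / 4 ->
  RtoC (v x) = CP a (RtoC (x - x0)).
Proof.
  intros Ha He Hx. rewrite <- ext_real.
  destruct (ext_local v M rho x0 x 0 a Ha He) as [E _].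
  - rewrite Rabs_R0, Rplus_0_r. exact Hx.
  - exact E.
Qed.

Lemma constant_of_coefs (v : R -> R) (M rho x0 x : R) (a : nat -> C) :
  geo M rho a -> expansion v x0 rho a -> ~ (exists n, a (S n) <> 0) ->
  rho * Rabs (x - x0) < 1 / 4 -> v x = v x0.
Proof.
  intros Ha He No Hx.
  assert (E : forall z, CP a z = a O).
  { intro z. rewrite <- (CP_0 a). unfold CP. apply CSeries_ext. intro k.
    destruct k as [|k]; [reflexivity|].
    replace (a (S k)) with (RtoC 0).
    - ring.
    - apply NNPP. intro K. apply No. exists k. auto. }
  apply RtoC_inj. rewrite !(real_local v M rho x0 _ a); auto.
  - rewrite !E. reflexivity.
  - rewrite Rminus_diag_eq, Rabs_R0; lra.
Qed.

Lemma inv_radius (rho s : R) : 0 < rho -> s < / (4 * rho) -> rho * s < 1 / 4.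
Proof.
  intros Hr Hs. apply Rmult_lt_compat_l with (r := rho) in Hs; auto.
  replace (rho * / (4 * rho)) with (1 / 4) in Hs by (field; lra). exact Hs.
Qed.

Lemma constant_or_finite (v : R -> R) (c : R) : real_analytic v ->
  exists eta, 0 < eta /\
    ((forall x, Rabs (x - c) < eta -> v x = v c) \/
     (forall w, exists l : list R, forall x, Rabs (x - c) < eta -> v x = w -> In (x - c) l)).
Proof.
  intro Hv. destruct (analytic_expansion v c Hv) as [M [rho [a [Ha [Hr He]]]]].
  assert (Near := fun x => inv_radius rho (Rabs (x - c)) Hr).
  assert (P : 0 < / (4 * rho)) by (apply Rinv_0_lt_compat; lra).
  destruct (classic (exists n, a (S n) <> 0)) as [[n Hn]|No].
  - destruct (CP_level_finite M rho a n Ha Hr Hn) as [r [Hr0 Hl]].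
    exists (Rmin r (/ (4 * rho))). split; [apply Rmin_pos; auto|]. right.
    intro w. destruct (Hl (RtoC w)) as [l Hl'].
    exists (map Re l). intros x Hx Hw.
    replace (x - c) with (Re (RtoC (x - c))) by reflexivity. apply in_map. apply Hl'.
    + rewrite Cmod_R. left. eapply Rlt_le_trans; [exact Hx | apply Rmin_l].
    + rewrite <- (real_local v M rho); auto.
      * rewrite Hw. reflexivity.
      * apply Near. eapply Rlt_le_trans; [exact Hx | apply Rmin_r].
  - exists (/ (4 * rho)). split; auto. left. intros x Hx.
    apply (constant_of_coefs v M rho c x a); auto.
Qed.

(** Let [c] be the supremum of the points up to which [v] stays constant. The level [v x0] is taken
    at all points just left of [c], which rules out the finite alternative of [constant_or_finite];
    the constant alternative pushes [c] further. *)
Lemma locally_constant_right (v : R -> R) (x0 eta x1 : R) : real_analytic v -> 0 < eta ->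
  (forall x, Rabs (x - x0) < eta -> v x = v x0) -> x0 <= x1 -> v x1 = v x0.
Proof.
  intros Hv Heta H0 H01. apply NNPP. intro Hne.
  set (E := fun t => x0 <= t /\ forall s, x0 <= s <= t -> v s = v x0).
  assert (Ub : bound E).
  { exists x1. intros t [Ht1 Ht2]. apply Rnot_lt_le. intro K. apply Hne. apply Ht2. lra. }
  assert (Ein : E (x0 + eta / 2)).
  { split; [lra|]. intros s Hs. apply H0. rewrite Rabs_pos_eq; lra. }
  destruct (completeness E Ub (ex_intro _ _ Ein)) as [c [Hc1 Hc2]].
  assert (Hc : x0 + eta / 2 <= c) by (apply Hc1; exact Ein).
  assert (Before : forall s, x0 <= s < c -> v s = v x0).
  { intros s Hs. apply NNPP. intro K. assert (c <= s); [|lra].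
    apply Hc2. intros t [Ht1 Ht2]. apply Rnot_lt_le. intro L. apply K. apply Ht2. lra. }
  destruct (constant_or_finite v c Hv) as [e [He [Hcst|Hfin]]].
  - set (h := Rmin (eta / 2) (e / 2)).
    assert (h0 : 0 < h) by (apply Rmin_pos; lra).
    assert (h1 : h <= eta / 2) by apply Rmin_l. assert (h2 : h <= e / 2) by apply Rmin_r.
    assert (Ec : v c = v x0).
    { rewrite <- (Hcst (c - h)).
      - apply Before. lra.
      - replace (c - h - c) with (- h) by ring. rewrite Rabs_Ropp, Rabs_pos_eq; lra. }
    assert (In1 : E (c + h)).
    { split; [lra|]. intros s Hs. destruct (Rlt_le_dec s c) as [L|L].
      - apply Before. lra.
      - rewrite <- Ec. apply Hcst. rewrite Rabs_pos_eq; lra. }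
    specialize (Hc1 _ In1). lra.
  - destruct (Hfin (v x0)) as [l Hl].
    set (h := Rmin (eta / 2) (e / 2)).
    assert (h0 : 0 < h) by (apply Rmin_pos; lra).
    assert (h1 : h <= eta / 2) by apply Rmin_l. assert (h2 : h <= e / 2) by apply Rmin_r.
    destruct (avoid_list l (- h) (- h / 2)) as [a [b [A1 [A2 [A3 A4]]]]]; [lra|].
    apply (A4 a); [lra|]. replace a with ((c + a) - c) by ring. apply Hl.
    + replace (c + a - c) with a by ring. rewrite Rabs_left; lra.
    + apply Before. lra.
Qed.

Lemma periodic_Z (v : R -> R) : one_periodic v -> forall (k : Z) x, v (x + IZR k) = v x.
Proof.
  intros Hp k. induction k using Z.peano_ind; intro x.
  - f_equal. ring.
  - rewrite succ_IZR, <- Rplus_assoc, Hp. apply IHk.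
  - rewrite <- (IHk x), <- Hp. f_equal. rewrite <- Z.sub_1_r, minus_IZR. ring.
Qed.

Lemma unit_shift (x : R) : exists (k : Z) (t : R), 0 <= t <= 1 /\ x = t + IZR k.
Proof.
  destruct (archimed x) as [A B]. exists (up x - 1)%Z, (x - IZR (up x - 1)).
  rewrite minus_IZR. split; lra.
Qed.

Lemma not_locally_constant (v : R -> R) (x0 : R) :
  real_analytic v -> one_periodic v -> non_constant v ->
  forall M rho a, geo M rho a -> 0 < rho -> expansion v x0 rho a -> exists n, a (S n) <> 0.
Proof.
  intros Hv Hp [y1 [y2 Hne]] M rho a Ha Hr He. apply NNPP. intro No.
  assert (P : 0 < / (4 * rho)) by (apply Rinv_0_lt_compat; lra).
  assert (Loc : forall x, Rabs (x - x0) < / (4 * rho) -> v x = v x0).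
  { intros x Hx. apply (constant_of_coefs v M rho x0 x a); auto. apply inv_radius; assumption. }
  assert (All : forall y, v y = v x0).
  { intro y. destruct (archimed (x0 - y)) as [A _].
    rewrite <- (periodic_Z v Hp (up (x0 - y)) y).
    apply (locally_constant_right v x0 (/ (4 * rho))); auto. lra. }
  apply Hne. rewrite (All y1), (All y2). reflexivity.
Qed.

(** * Periodicity and a strip of uniform width *)

Lemma taylor_shift (v : R -> R) : one_periodic v ->
  forall (k : Z) x n, taylor v (x + IZR k) n = taylor v x n.
Proof.
  intros Hp k x n. unfold taylor. rewrite <- Derive_n_comp_trans.
  rewrite (Derive_n_ext _ v); [reflexivity|]. intro t. apply periodic_Z; assumption.
Qed.

Lemma expansion_shift (v : R -> R) (x0 rho : R) (a : nat -> C) (k : Z) : one_periodic v ->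
  expansion v x0 rho a -> expansion v (x0 + IZR k) rho a.
Proof.
  intros Hp He x Hx n.
  replace x with ((x - IZR k) + IZR k) at 1 by ring. rewrite taylor_shift by assumption.
  replace (x - (x0 + IZR k)) with (x - IZR k - x0) in * by ring.
  apply He. exact Hx.
Qed.

Lemma ext_shift (v : R -> R) : one_periodic v ->
  forall (k : Z) x y, ext v (x + IZR k) y = ext v x y.
Proof.
  intros Hp k x y. unfold ext. apply CP_ext. intro; apply taylor_shift; assumption.
Qed.

(** [D] sets both the size of the box and, as [/ D], the bound on it. Both weaken as [D] decreases,
    so a single number can be fed to compactness. The box has size [2 * D] so that it still contains
    the [D]-neighbourhood of each point within [D] of its centre. *)
Definition good_box (v : R -> R) (x0 D : R) : Prop :=
  (forall x y, Rabs (x - x0) < 2 * D -> Rabs y < 2 * D ->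
     holo_at (ext v) (ext1 v) (ext2 v) x y /\ Cmod (ext v x y) <= / D) /\
  (forall w, exists l : list R, forall x y, Rabs (x - x0) < 2 * D -> Rabs y < 2 * D ->
     ext v x y = w -> In y l).

Lemma good_box_exists (v : R -> R) (x0 : R) :
  real_analytic v -> one_periodic v -> non_constant v ->
  exists D : posreal, forall k : Z, good_box v (x0 + IZR k) D.
Proof.
  intros Hv Hp Hn. destruct (analytic_expansion v x0 Hv) as [M [rho [a [Ha [Hr He]]]]].
  destruct (not_locally_constant v x0 Hv Hp Hn M rho a Ha Hr He) as [n Hn'].
  destruct (CP_level_finite M rho a n Ha Hr Hn') as [r [Hr0 Hl]].
  assert (HM : 0 <= M) by apply Ha.
  (* The three terms keep the box inside the disc of finite level sets, inside the range of
     [ext_holo_local], and make [/ D] exceed the bound [2 * M] on the series. *)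
  set (D := Rmin (r / 4) (Rmin (/ (128 * rho)) (/ (2 * M + 1)))).
  assert (D0 : 0 < D).
  { apply Rmin_pos; [lra|]. apply Rmin_pos; apply Rinv_0_lt_compat; lra. }
  assert (D1 : D <= r / 4) by apply Rmin_l.
  assert (D2 : D <= / (128 * rho)) by (eapply Rle_trans; [apply Rmin_r | apply Rmin_l]).
  assert (D3 : D <= / (2 * M + 1)) by (eapply Rle_trans; [apply Rmin_r | apply Rmin_r]).
  assert (D2' : 128 * (rho * D) <= 1).
  { apply Rmult_le_compat_l with (r := 128 * rho) in D2; [|lra].
    rewrite Rinv_r in D2 by lra. lra. }
  assert (D3' : 2 * M <= / D).
  { apply Rle_trans with (2 * M + 1); [lra|].
    rewrite <- (Rinv_inv (2 * M + 1)). apply Rinv_le_contravar; assumption. }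
  assert (Small : forall x y x1, Rabs (x - x1) < 2 * D -> Rabs y < 2 * D ->
     rho * (Rabs (x - x1) + Rabs y) < 1 / 16).
  { intros x y x1 Hx Hy. apply Rlt_le_trans with (rho * (4 * D)); [|lra].
    apply Rmult_lt_compat_l; lra. }
  exists (mkposreal D D0). intro k. simpl.
  pose proof (expansion_shift v x0 rho a k Hp He) as Hk.
  split.
  - intros x y Hx Hy. specialize (Small x y _ Hx Hy). split.
    + apply (ext_holo_local v M rho (x0 + IZR k) x y a); auto. lra.
    + destruct (ext_local v M rho (x0 + IZR k) x y a Ha Hk) as [E _]; [lra|].
      rewrite E. eapply Rle_trans; [|exact D3'].
      unfold CP. eapply Rle_trans.
      * apply CSeries_norm_le with (b := fun k => M * (1 / 2) ^ k).
        -- apply (geo_term M rho); auto.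
           pose proof (Cmod_le_abs (x - (x0 + IZR k)) y).
           apply Rle_trans with (rho * (Rabs (x - (x0 + IZR k)) + Rabs y)); [|lra].
           apply Rmult_le_compat_l; lra.
        -- apply ex_geom; lra.
      * rewrite Series_geom_scal by lra. lra.
  - intro w. destruct (Hl w) as [l Hl']. exists (map Im l). intros x y Hx Hy Hw.
    specialize (Small x y _ Hx Hy).
    destruct (ext_local v M rho (x0 + IZR k) x y a Ha Hk) as [E _]; [lra|].
    change y with (Im ((x - (x0 + IZR k))%R, y)). apply in_map. apply Hl'.
    + eapply Rle_trans; [apply Cmod_le_abs|]. lra.
    + rewrite <- E. exact Hw.
Qed.

Lemma strip_exists (v : R -> R) :
  real_analytic v -> one_periodic v -> non_constant v ->
  exists d B, 0 < d /\ 0 <= B /\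
    (forall x y, Rabs y < d -> holo_at (ext v) (ext1 v) (ext2 v) x y /\ Cmod (ext v x y) <= B) /\
    (forall w, exists l : list R, forall x y, Rabs y < d -> ext v x y = w -> In y l).
Proof.
  intros Hv Hp Hn.
  set (D := fun x0 => proj1_sig (constructive_indefinite_description _ (good_box_exists v x0 Hv Hp Hn))).
  assert (HD : forall x0 k, good_box v (x0 + IZR k) (D x0)).
  { intro x0. exact (proj2_sig (constructive_indefinite_description _ (good_box_exists v x0 Hv Hp Hn))). }
  (* Every [t] in the unit interval lies within [D u] of some [u] with [d <= D u]; the conclusion is
     doubly negated, hence [NNPP] below. *)
  destruct (compactness_value_1d 0 1 D) as [d Hd].
  pose proof (cond_pos d) as d0.
  exists d, (/ d). split; [exact d0|]. split; [left; apply Rinv_0_lt_compat; exact d0|].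
  split.
  - intros x y Hy. destruct (unit_shift x) as [k [t [Ht ->]]].
    specialize (Hd t Ht). apply NNPP in Hd. destruct Hd as [u [Hu [Hut Hdu]]].
    pose proof (cond_pos (D u)).
    destruct (HD u k) as [H1 _].
    destruct (H1 (t + IZR k) y) as [A B].
    + replace (t + IZR k - (u + IZR k)) with (t - u) by ring. lra.
    + lra.
    + split; auto. eapply Rle_trans; [exact B|]. apply Rinv_le_contravar; assumption.
  - intro w.
    assert (Step : forall x0, 0 <= x0 <= 1 -> exists l : list R,
       forall x y, Rabs (x - x0) < d -> Rabs y < d -> ext v x y = w -> In y l).
    { intros x0 H0. specialize (Hd x0 H0). apply NNPP in Hd. destruct Hd as [u [Hu [Hut Hdu]]].
      destruct (HD u 0%Z) as [_ H2]. destruct (H2 w) as [l Hl]. exists l.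
      intros x y Hx Hy. pose proof (cond_pos (D u)). apply Hl.
      - replace (x - (u + 0)) with ((x - x0) + (x0 - u)) by ring.
        eapply Rle_lt_trans; [apply Rabs_triang|]. lra.
      - lra. }
    (* The period is exhausted in steps of length [d / 2], appending the finite list of each
       step. *)
    assert (Ind : forall m : nat, exists l : list R, forall x y, 0 <= x <= 1 ->
       x < INR m * (d / 2) -> Rabs y < d -> ext v x y = w -> In y l).
    { induction m as [|m [l Hl]].
      - exists nil. simpl. intros; lra.
      - destruct (Rle_lt_dec (INR m * (d / 2)) 1) as [L|L].
        + destruct (Step (INR m * (d / 2))) as [l' Hl'].
          { split; auto. apply Rmult_le_pos; [apply pos_INR | lra]. }
          exists (l ++ l'). intros x y Hx Hxm Hy Hw. apply in_or_app.
          destruct (Rlt_le_dec x (INR m * (d / 2))) as [K|K].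
          * left. apply (Hl x y); auto.
          * right. apply (Hl' x y); auto. rewrite S_INR in Hxm. rewrite Rabs_pos_eq; lra.
        + exists l. intros x y Hx Hxm Hy Hw. apply (Hl x y); auto. lra. }
    destruct (Ind (Z.to_nat (up (2 / d)))) as [l Hl].
    exists l. intros x y Hy Hw. destruct (unit_shift x) as [k [t [Ht ->]]].
    rewrite ext_shift in Hw by assumption. apply (Hl t y); auto.
    destruct (archimed (2 / d)) as [A _].
    assert (P2 : 0 < 2 / d) by (apply Rdiv_lt_0_compat; lra).
    rewrite INR_IZR_INZ, Z2Nat.id by (apply le_IZR; lra).
    apply Rle_lt_trans with 1; [lra|].
    apply Rmult_lt_compat_r with (r := d / 2) in A; [|lra].
    replace (2 / d * (d / 2)) with 1 in A by (field; lra). exact A.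
Qed.

(** * Horizontal lines on which [V] stays away from finitely many real values *)

Lemma cont2_close (f : R -> R -> C) (x y eps : R) : 0 < eps -> cont2 f x y ->
  exists e, 0 < e /\ forall u w, Rabs (u - x) < e -> Rabs (w - y) < e ->
    Cmod (f u w - f x y)%C <= eps.
Proof.
  intros He [A B]. assert (He2 : 0 < eps / 2) by lra.
  destruct (A (mkposreal _ He2)) as [e1 H1]. destruct (B (mkposreal _ He2)) as [e2 H2].
  pose proof (cond_pos e1). pose proof (cond_pos e2).
  exists (Rmin e1 e2). split; [apply Rmin_pos; assumption|]. intros u w Hu Hw.
  pose proof (Rmin_l e1 e2). pose proof (Rmin_r e1 e2).
  specialize (H1 u w ltac:(lra) ltac:(lra)). specialize (H2 u w ltac:(lra) ltac:(lra)).
  simpl in H1, H2.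
  replace (f u w - f x y)%C with
    ((Re (f u w) - Re (f x y))%R, (Im (f u w) - Im (f x y))%R)
    by (destruct (f u w), (f x y); reflexivity).
  eapply Rle_trans; [apply Cmod_le_abs|]. lra.
Qed.

Record strip_function (V : R -> R -> C) (d B : R) : Prop := {
  strip_shift : forall (k : Z) x y, V (x + IZR k) y = V x y;
  strip_cont : forall x y, Rabs y < d -> cont2 V x y;
  strip_bound : forall x y, Rabs y < d -> Cmod (V x y) <= B;
  strip_level : forall w, exists l : list R, forall x y, Rabs y < d -> V x y = w -> In y l }.

Lemma Cmod_lower (z w : C) : Cmod w - Cmod z <= Cmod (z - w)%C.
Proof.
  assert (H : Cmod w <= Cmod z + Cmod (z - w)%C).
  { replace w with (z + - (z - w))%C at 1 by ring.
    eapply Rle_trans; [apply Cmod_triangle|]. rewrite Cmod_opp. lra. }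
  lra.
Qed.

(** On a band free of the level [w] the distance [|V - w|] is positive and continuous; periodicity
    and compactness of one period rectangle bound it below. [D] is at once a radius and a lower
    bound valid within it. *)
Lemma gap_pointwise (V : R -> R -> C) (d B a b : R) (w : C) :
  strip_function V d B -> - d < a -> a < b -> b < d ->
  exists a' b' c, a <= a' /\ a' < b' /\ b' <= b /\ 0 < c /\
    forall x y, a' <= y <= b' -> c <= Cmod (V x y - w)%C.
Proof.
  intros HV Ha Hab Hb. destruct (strip_level _ _ _ HV w) as [l Hl].
  destruct (avoid_list l a b Hab) as [a' [b' [A1 [A2 [A3 A4]]]]].
  assert (Ex : forall u v, exists D : posreal, a' <= v <= b' ->
     forall x y, Rabs (x - u) < D -> Rabs (y - v) < D -> D <= Cmod (V x y - w)%C).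
  { intros u v. destruct (classic (a' <= v <= b')) as [Hv|Hv].
    2:{ exists (mkposreal 1 Rlt_0_1). tauto. }
    assert (Hvd : Rabs v < d) by (apply Rabs_def1; lra).
    assert (N : 0 < Cmod (V u v - w)%C).
    { apply Cmod_gt_0. intro K. apply (A4 v Hv). apply (Hl u v Hvd).
      replace (V u v) with ((V u v - w) + w)%C by ring. rewrite K. ring. }
    destruct (cont2_close V u v (Cmod (V u v - w)%C / 2)) as [e [He H]]; [lra| |].
    { apply (strip_cont _ _ _ HV); assumption. }
    assert (P : 0 < Rmin e (Cmod (V u v - w)%C / 2)) by (apply Rmin_pos; lra).
    exists (mkposreal _ P). simpl. intros _ x y Hx Hy.
    pose proof (Rmin_l e (Cmod (V u v - w)%C / 2)). pose proof (Rmin_r e (Cmod (V u v - w)%C / 2)).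
    specialize (H x y ltac:(lra) ltac:(lra)).
    pose proof (Cmod_lower (V x y - V u v)%C (w - V u v)%C) as T.
    replace (V x y - V u v - (w - V u v))%C with (V x y - w)%C in T by ring.
    replace (w - V u v)%C with (- (V u v - w))%C in T by ring. rewrite Cmod_opp in T. lra. }
  set (D := fun u v => proj1_sig (constructive_indefinite_description _ (Ex u v))).
  assert (HD : forall u v, a' <= v <= b' ->
     forall x y, Rabs (x - u) < D u v -> Rabs (y - v) < D u v -> D u v <= Cmod (V x y - w)%C).
  { intros u v. exact (proj2_sig (constructive_indefinite_description _ (Ex u v))). }
  destruct (compactness_value_2d 0 1 a' b' D) as [c Hc].
  exists a', b', c. repeat split; auto using cond_pos.
  intros x y Hy. destruct (unit_shift x) as [k [t [Ht ->]]].
  rewrite (strip_shift _ _ _ HV). specialize (Hc t y Ht Hy). apply NNPP in Hc.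
  destruct Hc as [u [v [Hu [Hv [H1 [H2 H3]]]]]].
  eapply Rle_trans; [exact H3|]. apply (HD u v); auto.
Qed.

(** Compactness in the pair of parameters [(al, w)]. The margins [h / 4] absorb a displacement of
    [al] by at most [D], and the bound [2 * D] at the centre leaves [D] once [w] has moved by at
    most [D]. *)
Lemma gap_bounded (V : R -> R -> C) (d B e h W : R) :
  strip_function V d B -> e < d -> 0 < h ->
  exists c, 0 < c /\ forall al w, 0 <= al -> al + h <= e -> Rabs w <= W ->
    exists be, al <= be /\ be + c <= al + h /\
      forall x y, be <= y <= be + c -> c <= Cmod (V x y - w)%C.
Proof.
  intros HV He Hh.
  assert (Ex : forall al w, exists D : posreal, 0 <= al <= e - h ->
     D <= h / 4 /\ exists a' b', al + h / 4 <= a' /\ a' + D <= b' /\ b' <= al + 3 * h / 4 /\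
     forall x y, a' <= y <= b' -> 2 * D <= Cmod (V x y - RtoC w)%C).
  { intros al w. destruct (classic (0 <= al <= e - h)) as [Ha|Ha].
    2:{ exists (mkposreal 1 Rlt_0_1). tauto. }
    destruct (gap_pointwise V d B (al + h / 4) (al + 3 * h / 4) (RtoC w) HV)
      as [a' [b' [c [A1 [A2 [A3 [A4 A5]]]]]]]; try lra.
    assert (P : 0 < Rmin (h / 4) (Rmin (b' - a') (c / 2))).
    { apply Rmin_pos; [lra|]. apply Rmin_pos; lra. }
    pose proof (Rmin_l (h / 4) (Rmin (b' - a') (c / 2))).
    pose proof (Rmin_r (h / 4) (Rmin (b' - a') (c / 2))).
    pose proof (Rmin_l (b' - a') (c / 2)). pose proof (Rmin_r (b' - a') (c / 2)).
    exists (mkposreal _ P). simpl. intros _. split; auto.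
    exists a', b'. repeat split; try lra. intros x y Hy. specialize (A5 x y Hy). lra. }
  set (D := fun u v => proj1_sig (constructive_indefinite_description _ (Ex u v))).
  assert (HD : forall al w, 0 <= al <= e - h ->
     D al w <= h / 4 /\ exists a' b', al + h / 4 <= a' /\ a' + D al w <= b' /\ b' <= al + 3 * h / 4 /\
     forall x y, a' <= y <= b' -> 2 * D al w <= Cmod (V x y - RtoC w)%C).
  { intros u v. exact (proj2_sig (constructive_indefinite_description _ (Ex u v))). }
  destruct (compactness_value_2d 0 (e - h) (- W) W D) as [c Hc].
  exists c. split; [apply cond_pos|]. intros al w Hal Hah Hw.
  specialize (Hc al w ltac:(lra) (proj1 (Rabs_le_between w W) Hw)). apply NNPP in Hc.
  destruct Hc as [u [v [Hu [Hv [H1 [H2 H3]]]]]].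
  destruct (HD u v Hu) as [D4 [a' [b' [A1 [A2 [A3 A4]]]]]].
  apply Rabs_def2 in H1.
  exists a'. repeat split; try lra.
  intros x y Hy. specialize (A4 x y ltac:(lra)).
  pose proof (Cmod_lower (RtoC w - RtoC v)%C (V x y - RtoC v)%C) as T.
  replace (RtoC w - RtoC v - (V x y - RtoC v))%C with (- (V x y - RtoC w))%C in T by ring.
  rewrite Cmod_opp, <- RtoC_minus, Cmod_R in T. lra.
Qed.

Lemma gap_any (V : R -> R -> C) (d B e h : R) :
  strip_function V d B -> 0 <= B -> e < d -> 0 < h ->
  exists c, 0 < c /\ forall al w, 0 <= al -> al + h <= e ->
    exists be, al <= be /\ be + c <= al + h /\
      forall x y, be <= y <= be + c -> c * (1 + Rabs w) <= Cmod (V x y - w)%C.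
Proof.
  intros HV HB He Hh.
  destruct (gap_bounded V d B e h (2 * B + 1) HV He Hh) as [c0 [Hc0 H]].
  (* [2 * B + 2] bounds [1 + |w|] in the compact range. Beyond it [|w| - B] exceeds [(1 + |w|) / 4],
     and any band of thickness at most [h] will do. *)
  set (c := Rmin (c0 / (2 * B + 2)) (Rmin (1 / 4) h)).
  assert (P1 : 0 < c0 / (2 * B + 2)) by (apply Rdiv_lt_0_compat; lra).
  assert (c_pos : 0 < c) by (apply Rmin_pos; [|apply Rmin_pos]; lra).
  assert (c_1 : c <= c0 / (2 * B + 2)) by apply Rmin_l.
  assert (c_2 : c <= 1 / 4) by (eapply Rle_trans; [apply Rmin_r | apply Rmin_l]).
  assert (c_3 : c <= h) by (eapply Rle_trans; [apply Rmin_r | apply Rmin_r]).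
  assert (c_4 : c * (2 * B + 2) <= c0).
  { apply Rmult_le_compat_r with (r := 2 * B + 2) in c_1; [|lra].
    replace (c0 / (2 * B + 2) * (2 * B + 2)) with c0 in c_1 by (field; lra). exact c_1. }
  exists c. split; auto. intros al w Hal Hah.
  destruct (Rle_lt_dec (Rabs w) (2 * B + 1)) as [Hw|Hw].
  - destruct (H al w Hal Hah Hw) as [be [B1 [B2 B3]]].
    assert (c <= c0) by nra.
    exists be. repeat split; try lra. intros x y Hy.
    specialize (B3 x y ltac:(lra)). pose proof (Rabs_pos w). nra.
  - exists al. repeat split; try lra. intros x y Hy.
    assert (Hyd : Rabs y < d) by (apply Rabs_def1; lra).
    pose proof (strip_bound _ _ _ HV x y Hyd).
    pose proof (Cmod_lower (V x y) (RtoC w)) as T. rewrite Cmod_R in T. nra.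
Qed.

(** [c] is fixed before [al] and [l]. Each further value applies [gap_any] inside the band already
    found, whose thickness is known in advance, so the final thickness depends on the number of
    values only. *)
Lemma gap_list (V : R -> R -> C) (d B e : R) (q : nat) :
  strip_function V d B -> 0 <= B -> e < d -> forall h, 0 < h ->
  exists c, 0 < c /\ forall al, 0 <= al -> al + h <= e ->
    forall l : list R, (length l <= q)%nat ->
    exists be, al <= be /\ be + c <= al + h /\
      forall w x y, In w l -> be <= y <= be + c -> c * (1 + Rabs w) <= Cmod (V x y - w)%C.
Proof.
  intros HV HB He. induction q as [|q IH]; intros h Hh.
  - exists h. split; auto. intros al Hal Hah l Hl. exists al. repeat split; try lra.
    destruct l as [|w l]; [intros w x y [] | simpl in Hl; lia].
  - destruct (IH h Hh) as [c1 [C1 H1]].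
    destruct (gap_any V d B e c1 HV HB He C1) as [c2 [C2 H2]].
    pose proof (Rmin_l c1 c2). pose proof (Rmin_r c1 c2).
    exists (Rmin c1 c2). split; [apply Rmin_pos; assumption|].
    intros al Hal Hah l Hl. destruct l as [|w0 l].
    + destruct (H1 al Hal Hah nil ltac:(simpl; lia)) as [be [B1 [B2 _]]].
      exists be. repeat split; try lra. intros w x y [].
    + simpl in Hl. destruct (H1 al Hal Hah l ltac:(lia)) as [b1 [B1 [B2 B3]]].
      destruct (H2 b1 w0 ltac:(lra) ltac:(lra)) as [b2 [B4 [B5 B6]]].
      exists b2. repeat split; try lra. intros w x y Hw Hy. pose proof (Rabs_pos w).
      destruct Hw as [<-|Hw].
      * eapply Rle_trans; [|apply B6; lra]. apply Rmult_le_compat_r; lra.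
      * eapply Rle_trans; [|apply (B3 w x y Hw); lra]. apply Rmult_le_compat_r; lra.
Qed.

(** * Convexity of the mean of a logarithm along horizontal lines *)

Lemma is_derive_eq (f : R -> R) (x l l' : R) : is_derive f x l -> l = l' -> is_derive f x l'.
Proof. intros H <-. exact H. Qed.

Lemma is_derive_plusR (f g : R -> R) (x a b : R) :
  is_derive f x a -> is_derive g x b -> is_derive (fun t => f t + g t) x (a + b).
Proof. intros. apply (is_derive_plus (K := R_AbsRing) (V := R_NormedModule)); assumption. Qed.

Lemma is_derive_minusR (f g : R -> R) (x a b : R) :
  is_derive f x a -> is_derive g x b -> is_derive (fun t => f t - g t) x (a - b).
Proof. intros. apply (is_derive_minus (K := R_AbsRing) (V := R_NormedModule)); assumption. Qed.

Lemma is_derive_multR (f g : R -> R) (x a b : R) :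
  is_derive f x a -> is_derive g x b -> is_derive (fun t => f t * g t) x (a * g x + f x * b).
Proof. intros. apply (is_derive_mult f g); auto. intros; apply Rmult_comm. Qed.

Lemma is_derive_divR (f g : R -> R) (x a b : R) :
  is_derive f x a -> is_derive g x b -> g x <> 0 ->
  is_derive (fun t => f t / g t) x ((a * g x - f x * b) / (g x * g x)).
Proof.
  intros Hf Hg H0. eapply is_derive_eq; [apply is_derive_div; eassumption|].
  unfold minus, plus, opp, mult; simpl. field. assumption.
Qed.

Lemma continuity_2d_pt_swap (f : R -> R -> R) (x y : R) :
  continuity_2d_pt f x y -> continuity_2d_pt (fun u v => f v u) y x.
Proof.
  intros H eps. destruct (H eps) as [d Hd]. exists d. intros u v Hu Hv. apply Hd; assumption.
Qed.

Lemma continuity_2d_pt_slice (f : R -> R -> R) (x y : R) :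
  continuity_2d_pt f x y -> continuous (fun t => f t y) x.
Proof.
  intro H. apply filterlim_locally. intro eps. destruct (H eps) as [d Hd].
  exists d. intros t Ht. apply Hd; [exact Ht|].
  rewrite Rminus_diag_eq, Rabs_R0; auto using cond_pos.
Qed.

Lemma RInt_param_derive (P P' : R -> R -> R) (d y : R) :
  (forall x y, Rabs y < d -> is_derive (fun t => P x t) y (P' x y) /\
     continuity_2d_pt P x y /\ continuity_2d_pt P' x y) ->
  Rabs y < d ->
  is_derive (fun y => RInt (fun x => P x y) 0 1) y (RInt (fun x => P' x y) 0 1).
Proof.
  intros H Hy.
  assert (Pe : 0 < d - Rabs y) by lra.
  assert (Near : forall t, Rabs (t - y) < d - Rabs y -> Rabs t < d).
  { intros t Ht. replace t with ((t - y) + y) by ring.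
    eapply Rle_lt_trans; [apply Rabs_triang|]. lra. }
  assert (Hd : forall x y, Rabs y < d -> Derive (fun t => P x t) y = P' x y).
  { intros x t Ht. apply is_derive_unique. apply H; assumption. }
  assert (E : RInt (fun x => P' x y) 0 1 = RInt (fun x => Derive (fun t => P x t) y) 0 1).
  { apply RInt_ext. intros x _. symmetry. apply Hd. assumption. }
  rewrite E.
  apply (is_derive_RInt_param (fun y x => P x y)).
  - exists (mkposreal _ Pe). intros t Ht x _. exists (P' x t). apply H. apply Near. exact Ht.
  - intros x _. apply continuity_2d_pt_ext_loc with (f := fun u v => P' v u).
    + exists (mkposreal _ Pe). simpl. intros u v Hu _. symmetry. apply Hd. apply Near. exact Hu.
    + apply continuity_2d_pt_swap. apply H. assumption.
  - exists (mkposreal _ Pe). intros t Ht. apply (ex_RInt_continuous (V := R_CompleteNormedModule)). intros x _.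
    apply continuity_2d_pt_slice. apply H. apply Near. exact Ht.
Qed.

(** The mean slopes on [[0, a]] and [[a, b]] are values of [F1] at ordered points, compared by a
    third use of the mean value theorem. *)
Lemma convex_of_derive2 (F F1 F2 : R -> R) (d a b : R) :
  (forall y, Rabs y < d -> is_derive F y (F1 y)) ->
  (forall y, Rabs y < d -> is_derive F1 y (F2 y)) ->
  (forall y, Rabs y < d -> 0 <= F2 y) -> 0 < a < b -> b < d ->
  b * F a <= (b - a) * F 0 + a * F b.
Proof.
  intros H1 H2 H3 Hab Hb.
  assert (In : forall y, 0 <= y <= b -> Rabs y < d) by (intros; apply Rabs_def1; lra).
  assert (MVT1 : forall G G' u w, (forall y, Rabs y < d -> is_derive G y (G' y)) ->
     0 <= u -> u <= w -> w <= b -> exists c, u <= c <= w /\ G w - G u = G' c * (w - u)).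
  { intros G G' u w HG Hu Huw Hw.
    destruct (MVT_gen G u w G') as [c [Hc E]].
    - intros y Hy. rewrite Rmin_left, Rmax_right in Hy by assumption. apply HG, In. lra.
    - intros y Hy. rewrite Rmin_left, Rmax_right in Hy by assumption.
      apply continuity_pt_filterlim. apply (ex_derive_continuous (V := R_NormedModule)).
      exists (G' y). apply HG, In. lra.
    - rewrite Rmin_left, Rmax_right in Hc by assumption. exists c. split; auto. }
  destruct (MVT1 F F1 0 a H1) as [c1 [C1 E1]]; try lra.
  destruct (MVT1 F F1 a b H1) as [c2 [C2 E2]]; try lra.
  destruct (MVT1 F1 F2 c1 c2 H2) as [c3 [C3 E3]]; try lra.
  assert (0 <= F2 c3) by (apply H3, In; lra).
  assert (0 <= F1 c2 - F1 c1) by (rewrite E3; apply Rmult_le_pos; lra).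
  assert (0 <= a * (b - a) * (F1 c2 - F1 c1))
    by (apply Rmult_le_pos; [apply Rmult_le_pos; lra | assumption]).
  replace (F b) with (F 0 + F1 c1 * a + F1 c2 * (b - a)) by lra.
  replace (F a) with (F 0 + F1 c1 * a) by lra.
  lra.
Qed.

(** * Derivatives of the squared length of a holomorphic pair *)

Definition normsq (f g : R -> R -> C) (x y : R) : R :=
  Re (f x y) * Re (f x y) + Im (f x y) * Im (f x y)
  + (Re (g x y) * Re (g x y) + Im (g x y) * Im (g x y)).

(* [dotr + i dotc] is the Hermitian product of [(f, g)] and [(f1, g1)]. *)
Definition dotr (f g f1 g1 : R -> R -> C) (x y : R) : R :=
  Re (f x y) * Re (f1 x y) + Im (f x y) * Im (f1 x y)
  + (Re (g x y) * Re (g1 x y) + Im (g x y) * Im (g1 x y)).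

Definition dotc (f g f1 g1 : R -> R -> C) (x y : R) : R :=
  Im (f x y) * Re (f1 x y) - Re (f x y) * Im (f1 x y)
  + (Im (g x y) * Re (g1 x y) - Re (g x y) * Im (g1 x y)).

Ltac derive_tac :=
  eapply is_derive_eq;
  [ repeat lazymatch goal with
      | |- is_derive (fun t => @?a t + @?b t) _ _ => apply (is_derive_plusR a b)
      | |- is_derive (fun t => @?a t - @?b t) _ _ => apply (is_derive_minusR a b)
      | |- is_derive (fun t => @?a t * @?b t) _ _ => apply (is_derive_multR a b)
      | _ => eassumption
      end
  | unfold Re, Im; simpl; ring ].

Lemma normsq_derive (f g f1 g1 : R -> R -> C) (x y : R) :
  CRd f f1 x y -> CRd g g1 x y ->
  is_derive (fun t => normsq f g t y) x (2 * dotr f g f1 g1 x y) /\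
  is_derive (fun t => normsq f g x t) y (2 * dotc f g f1 g1 x y).
Proof.
  intros [A1 [A2 [A3 A4]]] [B1 [B2 [B3 B4]]]. unfold normsq, dotr, dotc.
  split; derive_tac.
Qed.

(** Differentiating twice in [y] brings the factor [i^2 = -1] to the terms with [f2] and [g2], so
    these cancel in the Laplacian. *)
Lemma dot_derive (f g f1 g1 f2 g2 : R -> R -> C) (x y : R) :
  CRd f f1 x y -> CRd g g1 x y -> CRd f1 f2 x y -> CRd g1 g2 x y ->
  is_derive (fun t => dotr f g f1 g1 t y) x (normsq f1 g1 x y + dotr f g f2 g2 x y) /\
  is_derive (fun t => dotc f g f1 g1 x t) y (normsq f1 g1 x y - dotr f g f2 g2 x y).
Proof.
  intros [A1 [A2 [A3 A4]]] [B1 [B2 [B3 B4]]] [C1 [C2 [C3 C4]]] [D1 [D2 [D3 D4]]].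
  unfold normsq, dotr, dotc. split; derive_tac.
Qed.

Ltac cont_tac :=
  repeat first [ assumption | apply continuity_2d_pt_minus | apply continuity_2d_pt_plus
               | apply continuity_2d_pt_mult | apply continuity_2d_pt_const ].

Lemma cont_normsq (f g : R -> R -> C) (x y : R) :
  cont2 f x y -> cont2 g x y -> continuity_2d_pt (normsq f g) x y.
Proof. intros [A1 A2] [B1 B2]. unfold normsq. cont_tac. Qed.

Lemma cont_dotr (f g f1 g1 : R -> R -> C) (x y : R) :
  cont2 f x y -> cont2 g x y -> cont2 f1 x y -> cont2 g1 x y ->
  continuity_2d_pt (dotr f g f1 g1) x y.
Proof. intros [A1 A2] [B1 B2] [C1 C2] [D1 D2]. unfold dotr. cont_tac. Qed.

Lemma cont_dotc (f g f1 g1 : R -> R -> C) (x y : R) :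
  cont2 f x y -> cont2 g x y -> cont2 f1 x y -> cont2 g1 x y ->
  continuity_2d_pt (dotc f g f1 g1) x y.
Proof. intros [A1 A2] [B1 B2] [C1 C2] [D1 D2]. unfold dotc. cont_tac. Qed.

(** Lagrange's identity: the defect is exactly [|f g1 - g f1|^2]. *)
Lemma cauchy_schwarz (f g f1 g1 : R -> R -> C) (x y : R) :
  dotr f g f1 g1 x y ^ 2 + dotc f g f1 g1 x y ^ 2 <= normsq f g x y * normsq f1 g1 x y.
Proof.
  apply Rminus_le. unfold dotr, dotc, normsq.
  destruct (f x y) as [a b], (g x y) as [a' b'], (f1 x y) as [c e], (g1 x y) as [c' e'].
  unfold Re, Im; simpl fst; simpl snd.
  replace (_ - _) with
    (- ((a * c' - b * e' - (a' * c - b' * e)) ^ 2 + (a * e' + b * c' - (a' * e + b' * c)) ^ 2))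
    by ring.
  pose proof (pow2_ge_0 (a * c' - b * e' - (a' * c - b' * e))).
  pose proof (pow2_ge_0 (a * e' + b * c' - (a' * e + b' * c))). lra.
Qed.

Lemma periodic_derive (P : R -> R) (l0 l1 : R) : (forall t, P (t + 1) = P t) ->
  is_derive P 0 l0 -> is_derive P 1 l1 -> l0 = l1.
Proof.
  intros Hp H0 H1.
  assert (H : is_derive (fun t => P (t + 1)) 0 l1).
  { eapply is_derive_eq.
    - apply (is_derive_comp P (fun t => t + 1)).
      + rewrite Rplus_0_l. exact H1.
      + apply is_derive_plusR; [apply is_derive_id | apply is_derive_const].
    - unfold scal, one, zero; simpl. unfold mult; simpl. ring. }
  apply (is_derive_ext _ P) in H; [|exact Hp].
  rewrite <- (is_derive_unique _ _ _ H0). apply is_derive_unique. exact H.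
Qed.

Lemma is_derive_ln_comp (S : R -> R) (x l : R) : 0 < S x -> is_derive S x l ->
  is_derive (fun t => ln (S t)) x (l / S x).
Proof.
  intros HS H. eapply is_derive_eq.
  - apply (is_derive_comp ln S); [|exact H]. apply is_derive_ln. exact HS.
  - unfold scal; simpl. unfold mult; simpl. field. lra.
Qed.

(* The second derivative of the mean is the mean of the Laplacian, because the
   [x]-part integrates to zero over a period; the Laplacian of [ln (|f|^2 + |g|^2)]
   is nonnegative by the Cauchy-Schwarz inequality. *)
Lemma mean_log_convex (f f1 f2 g g1 g2 : R -> R -> C) (d a b : R) :
  (forall x y, Rabs y < d -> holo_at f f1 f2 x y) ->
  (forall x y, Rabs y < d -> holo_at g g1 g2 x y) ->
  (forall x y, Rabs y < d -> 0 < normsq f g x y) ->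
  (forall x y, f (x + 1) y = f x y) -> (forall x y, g (x + 1) y = g x y) ->
  0 < a < b -> b < d ->
  b * RInt (fun x => ln (normsq f g x a)) 0 1 <=
  (b - a) * RInt (fun x => ln (normsq f g x 0)) 0 1 + a * RInt (fun x => ln (normsq f g x b)) 0 1.
Proof.
  intros Hf Hg HS Pf Pg Hab Hb.
  set (S := normsq f g). set (X := dotr f g f1 g1). set (Y := dotc f g f1 g1).
  set (T := normsq f1 g1). set (Z := dotr f g f2 g2).
  set (Py := fun x y => 2 * Y x y / S x y).
  set (Pyy := fun x y => (2 * (T x y - Z x y) * S x y - 2 * Y x y * (2 * Y x y)) / (S x y * S x y)).
  set (Px := fun x y => 2 * X x y / S x y).
  set (Pxx := fun x y => (2 * (T x y + Z x y) * S x y - 2 * X x y * (2 * X x y)) / (S x y * S x y)).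
  assert (CS : forall x y, Rabs y < d -> continuity_2d_pt S x y /\ continuity_2d_pt X x y /\
     continuity_2d_pt Y x y /\ continuity_2d_pt T x y /\ continuity_2d_pt Z x y).
  { intros x y Hy. destruct (Hf x y Hy) as [[_ F0] [[_ F1] F2]].
    destruct (Hg x y Hy) as [[_ G0] [[_ G1] G2]].
    split; [|split; [|split; [|split]]].
    - apply cont_normsq; assumption.
    - apply cont_dotr; assumption.
    - apply cont_dotc; assumption.
    - apply cont_normsq; assumption.
    - apply cont_dotr; assumption. }
  assert (Cinv : forall x y, Rabs y < d -> continuity_2d_pt (fun x y => / S x y) x y).
  { intros x y Hy. apply continuity_2d_pt_inv; [apply CS; auto|]. specialize (HS x y Hy).
    unfold S. lra. }
  assert (Cinv2 : forall x y, Rabs y < d -> continuity_2d_pt (fun x y => / (S x y * S x y)) x y).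
  { intros x y Hy. apply continuity_2d_pt_inv.
    - apply continuity_2d_pt_mult; apply CS; auto.
    - specialize (HS x y Hy). unfold S. nra. }
  assert (Cln : forall x y, Rabs y < d -> continuity_2d_pt (fun x y => ln (S x y)) x y).
  { intros x y Hy. apply continuity_1d_2d_pt_comp; [|apply CS; auto].
    apply continuity_pt_filterlim. apply (ex_derive_continuous (V := R_NormedModule)).
    exists (/ S x y). apply is_derive_ln. apply HS; auto. }
  assert (CPy : forall x y, Rabs y < d -> continuity_2d_pt Py x y).
  { intros x y Hy. destruct (CS x y Hy) as [C1 [C2 [C3 [C4 C5]]]]. specialize (Cinv x y Hy).
    unfold Py, Rdiv. cont_tac. }
  assert (CPyy : forall x y, Rabs y < d -> continuity_2d_pt Pyy x y).
  { intros x y Hy. destruct (CS x y Hy) as [C1 [C2 [C3 [C4 C5]]]]. specialize (Cinv2 x y Hy).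
    unfold Pyy, Rdiv. apply continuity_2d_pt_mult; [|assumption]. cont_tac. }
  assert (CPxx : forall x y, Rabs y < d -> continuity_2d_pt Pxx x y).
  { intros x y Hy. destruct (CS x y Hy) as [C1 [C2 [C3 [C4 C5]]]]. specialize (Cinv2 x y Hy).
    unfold Pxx, Rdiv. apply continuity_2d_pt_mult; [|assumption]. cont_tac. }
  assert (Der : forall x y, Rabs y < d ->
     is_derive (fun t => ln (S x t)) y (Py x y) /\ is_derive (fun t => Py x t) y (Pyy x y) /\
     is_derive (fun t => ln (S t y)) x (Px x y) /\ is_derive (fun t => Px t y) x (Pxx x y)).
  { intros x y Hy. destruct (Hf x y Hy) as [[F0 _] [[F1 _] _]].
    destruct (Hg x y Hy) as [[G0 _] [[G1 _] _]].
    destruct (normsq_derive f g f1 g1 x y F0 G0) as [Sx Sy].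
    destruct (dot_derive f g f1 g1 f2 g2 x y F0 G0 F1 G1) as [Xx Yy].
    specialize (HS x y Hy).
    assert (Dc : forall (u : R -> R) t l, is_derive u t l -> is_derive (fun s => 2 * u s) t (2 * l)).
    { intros u t l Hu. eapply is_derive_eq.
      - apply is_derive_multR; [apply is_derive_const | exact Hu].
      - unfold zero; simpl. ring. }
    split; [|split; [|split]].
    - apply (is_derive_ln_comp (fun t => S x t)); auto.
    - apply (is_derive_divR (fun t => 2 * Y x t) (fun t => S x t)); [apply Dc; exact Yy | exact Sy |].
      unfold S; lra.
    - apply (is_derive_ln_comp (fun t => S t y)); auto.
    - apply (is_derive_divR (fun t => 2 * X t y) (fun t => S t y)); [apply Dc; exact Xx | exact Sx |].
      unfold S; lra. }
  apply (convex_of_derive2 (fun y => RInt (fun x => ln (S x y)) 0 1)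
     (fun y => RInt (fun x => Py x y) 0 1) (fun y => RInt (fun x => Pyy x y) 0 1) d); auto.
  - intros y Hy. apply (RInt_param_derive (fun x y => ln (S x y)) Py d); auto.
    intros x t Ht. split; [|split]; auto. apply Der; auto.
  - intros y Hy. apply (RInt_param_derive Py Pyy d); auto.
    intros x t Ht. split; [|split]; auto. apply Der; auto.
  - intros y Hy.
    assert (Exx : is_RInt (fun x => Pxx x y) 0 1 0).
    { replace 0 with (minus (Px 1 y) (Px 0 y)) at 2.
      - apply (is_RInt_derive (fun x => Px x y)).
        + intros x _. apply Der; auto.
        + intros x _. apply continuity_2d_pt_slice. auto.
      - assert (E : Px 0 y = Px 1 y).
        { apply (periodic_derive (fun t => ln (S t y))); try (apply Der; auto).
          intro t. unfold S, normsq. rewrite Pf, Pg. reflexivity. }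
        rewrite E. unfold minus, plus, opp; simpl. ring. }
    assert (Eyy : ex_RInt (fun x => Pyy x y) 0 1).
    { apply (ex_RInt_continuous (V := R_CompleteNormedModule)). intros x _. apply continuity_2d_pt_slice. auto. }
    assert (E0 : RInt (fun x => Pxx x y) 0 1 = 0) by (apply is_RInt_unique; exact Exx).
    replace (RInt (fun x => Pyy x y) 0 1) with
      (RInt (fun x => Pyy x y) 0 1 + RInt (fun x => Pxx x y) 0 1) by (rewrite E0; ring).
    assert (Ex1 : ex_RInt (fun x => Pxx x y) 0 1) by (exists 0; exact Exx).
    rewrite <- (RInt_plus (V := R_CompleteNormedModule)) by assumption.
    apply RInt_ge_0; [lra| |].
    + apply (ex_RInt_plus (V := R_NormedModule)); assumption.
    + intros x _. unfold plus; simpl. unfold Pyy, Pxx. specialize (HS x y Hy).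
      fold S in HS.
      (* [Z] cancels in the Laplacian and the Cauchy-Schwarz defect remains. *)
      replace (_ + _) with (4 * (S x y * T x y - (X x y ^ 2 + Y x y ^ 2)) / (S x y * S x y))
        by (field; lra).
      apply Rmult_le_pos.
      * pose proof (cauchy_schwarz f g f1 g1 x y) as CSh. fold S X Y T in CSh. lra.
      * left. apply Rinv_0_lt_compat. nra.
Qed.

(** * The first column of the transfer matrix on the strip *)

Definition holo (d : R) (f : R -> R -> C) : Prop :=
  exists f1 f2, forall x y, Rabs y < d -> holo_at f f1 f2 x y.

Lemma CRd_plus (f f1 g g1 : R -> R -> C) (x y : R) : CRd f f1 x y -> CRd g g1 x y ->
  CRd (fun x y => f x y + g x y)%C (fun x y => f1 x y + g1 x y)%C x y.
Proof.
  intros [A1 [A2 [A3 A4]]] [B1 [B2 [B3 B4]]]. split; [|split; [|split]].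
  - change (is_derive (fun t => Re (f t y) + Re (g t y)) x (Re (f1 x y + g1 x y)%C)). derive_tac.
  - change (is_derive (fun t => Im (f t y) + Im (g t y)) x (Im (f1 x y + g1 x y)%C)). derive_tac.
  - change (is_derive (fun t => Re (f x t) + Re (g x t)) y (- Im (f1 x y + g1 x y)%C)). derive_tac.
  - change (is_derive (fun t => Im (f x t) + Im (g x t)) y (Re (f1 x y + g1 x y)%C)). derive_tac.
Qed.

Lemma CRd_mult (f f1 g g1 : R -> R -> C) (x y : R) : CRd f f1 x y -> CRd g g1 x y ->
  CRd (fun x y => f x y * g x y)%C (fun x y => f1 x y * g x y + f x y * g1 x y)%C x y.
Proof.
  intros [A1 [A2 [A3 A4]]] [B1 [B2 [B3 B4]]]. split; [|split; [|split]].
  - change (is_derive (fun t => Re (f t y) * Re (g t y) - Im (f t y) * Im (g t y)) x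
      (Re (f1 x y * g x y + f x y * g1 x y)%C)). derive_tac.
  - change (is_derive (fun t => Re (f t y) * Im (g t y) + Im (f t y) * Re (g t y)) x
      (Im (f1 x y * g x y + f x y * g1 x y)%C)). derive_tac.
  - change (is_derive (fun t => Re (f x t) * Re (g x t) - Im (f x t) * Im (g x t)) y
      (- Im (f1 x y * g x y + f x y * g1 x y)%C)). derive_tac.
  - change (is_derive (fun t => Re (f x t) * Im (g x t) + Im (f x t) * Re (g x t)) y
      (Re (f1 x y * g x y + f x y * g1 x y)%C)). derive_tac.
Qed.

Lemma CRd_const (c : C) (x y : R) : CRd (fun _ _ => c) (fun _ _ => RtoC 0) x y.
Proof.
  split; [|split; [|split]]; (eapply is_derive_eq; [apply is_derive_const|]);
    unfold zero; simpl; ring.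
Qed.

Lemma cont2_plus (f g : R -> R -> C) (x y : R) : cont2 f x y -> cont2 g x y ->
  cont2 (fun x y => f x y + g x y)%C x y.
Proof.
  intros [A B] [A' B']. split.
  - apply (continuity_2d_pt_plus (fun x y => Re (f x y)) (fun x y => Re (g x y))); assumption.
  - apply (continuity_2d_pt_plus (fun x y => Im (f x y)) (fun x y => Im (g x y))); assumption.
Qed.

Lemma cont2_mult (f g : R -> R -> C) (x y : R) : cont2 f x y -> cont2 g x y ->
  cont2 (fun x y => f x y * g x y)%C x y.
Proof.
  intros [A B] [A' B']. split.
  - apply (continuity_2d_pt_minus (fun x y => Re (f x y) * Re (g x y))
      (fun x y => Im (f x y) * Im (g x y))); apply continuity_2d_pt_mult; assumption.
  - apply (continuity_2d_pt_plus (fun x y => Re (f x y) * Im (g x y))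
      (fun x y => Im (f x y) * Re (g x y))); apply continuity_2d_pt_mult; assumption.
Qed.

Lemma cont2_const (c : C) (x y : R) : cont2 (fun _ _ => c) x y.
Proof. split; apply continuity_2d_pt_const. Qed.

Lemma holo_const (d : R) (c : C) : holo d (fun _ _ => c).
Proof.
  exists (fun _ _ => RtoC 0), (fun _ _ => RtoC 0). intros x y _.
  split; [|split; [|]]; [split| split |]; auto using CRd_const, cont2_const.
Qed.

Lemma holo_plus (d : R) (f g : R -> R -> C) :
  holo d f -> holo d g -> holo d (fun x y => f x y + g x y)%C.
Proof.
  intros [f1 [f2 Hf]] [g1 [g2 Hg]].
  exists (fun x y => f1 x y + g1 x y)%C, (fun x y => f2 x y + g2 x y)%C. intros x y Hy.
  destruct (Hf x y Hy) as [[A1 A2] [[A3 A4] A5]]. destruct (Hg x y Hy) as [[B1 B2] [[B3 B4] B5]].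
  split; [|split; [|]]; [split| split |]; auto using CRd_plus, cont2_plus.
Qed.

Lemma holo_mult (d : R) (f g : R -> R -> C) :
  holo d f -> holo d g -> holo d (fun x y => f x y * g x y)%C.
Proof.
  intros [f1 [f2 Hf]] [g1 [g2 Hg]].
  exists (fun x y => f1 x y * g x y + f x y * g1 x y)%C,
    (fun x y => (f2 x y * g x y + f1 x y * g1 x y) + (f1 x y * g1 x y + f x y * g2 x y))%C.
  intros x y Hy.
  destruct (Hf x y Hy) as [[A1 A2] [[A3 A4] A5]]. destruct (Hg x y Hy) as [[B1 B2] [[B3 B4] B5]].
  split; [|split; [|]]; [split| split |]; auto using CRd_plus, CRd_mult, cont2_plus, cont2_mult.
Qed.

Lemma CRd_shift (f f1 : R -> R -> C) (s x y : R) : CRd f f1 (x + s) y ->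
  CRd (fun x y => f (x + s)%R y) (fun x y => f1 (x + s)%R y) x y.
Proof.
  intros [A [B [C D]]].
  assert (Sh : forall (h : R -> R) l, is_derive h (x + s) l -> is_derive (fun t => h (t + s)) x l).
  { intros h l H. eapply is_derive_eq.
    - apply (is_derive_comp h (fun t => t + s)); [exact H|].
      apply is_derive_plusR; [apply is_derive_id | apply is_derive_const].
    - unfold scal, one, zero; simpl. unfold mult; simpl. ring. }
  split; [|split; [|split]]; auto.
  - apply (Sh (fun t => Re (f t y))). exact A.
  - apply (Sh (fun t => Im (f t y))). exact B.
Qed.

Lemma cont2_shift (f : R -> R -> C) (s x y : R) : cont2 f (x + s) y ->
  cont2 (fun x y => f (x + s)%R y) x y.
Proof.
  assert (Sh : forall h : R -> R -> R, continuity_2d_pt h (x + s) y ->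
     continuity_2d_pt (fun x y => h (x + s) y) x y).
  { intros h H eps. destruct (H eps) as [d Hd]. exists d. intros u w Hu Hw. apply Hd; auto.
    replace (u + s - (x + s)) with (u - x) by ring. exact Hu. }
  intros [A B]. split.
  - apply (Sh (fun u w => Re (f u w))). exact A.
  - apply (Sh (fun u w => Im (f u w))). exact B.
Qed.

Lemma holo_shift (d s : R) (f : R -> R -> C) : holo d f -> holo d (fun x y => f (x + s)%R y).
Proof.
  intros [f1 [f2 Hf]]. exists (fun x y => f1 (x + s)%R y), (fun x y => f2 (x + s)%R y).
  intros x y Hy. destruct (Hf (x + s) y Hy) as [[A1 A2] [[A3 A4] A5]].
  split; [|split; [|]]; [split| split |]; auto using CRd_shift, cont2_shift.
Qed.

(** Written with sums and products only, so that [holo_plus] and [holo_mult] apply directly. *)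
Definition diag (V : R -> R -> C) (lam : R) (v1 : Z -> R) (E om : R) (k : nat) (x y : R) : C :=
  (RtoC (E - v1 (Z.of_nat k))%R + - RtoC lam * V (x + INR k * om)%R y)%C.

Fixpoint col (V : R -> R -> C) (lam : R) (v1 : Z -> R) (E om : R) (N : nat) (x y : R) : C * C :=
  match N with
  | O => (RtoC 1, RtoC 0)
  | S m => let c := col V lam v1 E om m x y in
           ((diag V lam v1 E om (S m) x y * fst c + - RtoC 1 * snd c)%C, fst c)
  end.

Definition top V lam v1 E om N x y : C := fst (col V lam v1 E om N x y).
Definition bot V lam v1 E om N x y : C := snd (col V lam v1 E om N x y).

Lemma holo_col (V : R -> R -> C) (lam : R) (v1 : Z -> R) (E om d : R) (N : nat) :
  holo d V -> holo d (top V lam v1 E om N) /\ holo d (bot V lam v1 E om N).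
Proof.
  intro HV. induction N as [|N [IH1 IH2]].
  - split; [exact (holo_const d (RtoC 1)) | exact (holo_const d (RtoC 0))].
  - split; [|exact IH1].
    apply (holo_plus d (fun x y => diag V lam v1 E om (S N) x y * top V lam v1 E om N x y)%C
      (fun x y => - RtoC 1 * bot V lam v1 E om N x y)%C).
    + apply holo_mult; [|exact IH1]. apply holo_plus; [apply holo_const|].
      apply holo_mult; [apply holo_const|]. apply holo_shift. exact HV.
    + apply holo_mult; [apply holo_const | exact IH2].
Qed.

Lemma normsq_Cmod (f g : R -> R -> C) (x y : R) :
  normsq f g x y = Cmod (f x y) ^ 2 + Cmod (g x y) ^ 2.
Proof. unfold normsq. rewrite !Cmod2_alt. ring. Qed.

(** Each step is invertible, so a zero column would force the previous one to vanish, down to the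
    initial [(1, 0)]. *)
Lemma col_nonzero (V : R -> R -> C) (lam : R) (v1 : Z -> R) (E om : R) (N : nat) (x y : R) :
  0 < normsq (top V lam v1 E om N) (bot V lam v1 E om N) x y.
Proof.
  assert (H : top V lam v1 E om N x y <> 0 \/ bot V lam v1 E om N x y <> 0).
  { induction N as [|N IH].
    - left. unfold top; simpl. exact C1_nz.
    - apply NNPP. intro K. apply not_or_and in K. destruct K as [K1 K2].
      apply NNPP in K1. apply NNPP in K2. unfold top, bot in *. simpl in K1, K2.
      rewrite K2 in *. destruct IH as [IH|IH]; apply IH; auto.
      replace (snd (col V lam v1 E om N x y)) with
        (- (diag V lam v1 E om (S N) x y * 0 + - RtoC 1 * snd (col V lam v1 E om N x y)))%C by ring.
      rewrite K1. ring. }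
  rewrite normsq_Cmod.
  pose proof (pow2_ge_0 (Cmod (top V lam v1 E om N x y))).
  pose proof (pow2_ge_0 (Cmod (bot V lam v1 E om N x y))).
  destruct H as [H|H]; apply Cmod_gt_0 in H; nra.
Qed.

Lemma col_periodic (V : R -> R -> C) (lam : R) (v1 : Z -> R) (E om : R) (N : nat) :
  (forall x y, V (x + 1) y = V x y) ->
  forall x y, col V lam v1 E om N (x + 1) y = col V lam v1 E om N x y.
Proof.
  intros HV x y. induction N as [|N IH]; [reflexivity|]. simpl. rewrite IH.
  unfold diag. replace (x + 1 + INR (S N) * om) with (x + INR (S N) * om + 1) by ring.
  rewrite HV. reflexivity.
Qed.

(** * Growth of the column on a horizontal line *)

Fixpoint lnsum (g : nat -> R) (N : nat) : R :=
  match N with O => 0 | S m => lnsum g m + g (S m) end.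

Lemma lnsum_ge (g : nat -> R) (N : nat) (l : R) : (forall k, l <= g k) -> INR N * l <= lnsum g N.
Proof.
  intro H. induction N as [|N IH]; [simpl; lra|]. rewrite S_INR. simpl. specialize (H (S N)). lra.
Qed.

(** The cone [|bot| <= |top|] is invariant: inside it the new upper entry is at least
    [(m - 1) |top|], hence at least [(m / 2) |top|] because [m >= 2], and the new lower entry is the
    old [top]. *)
Lemma top_growth (V : R -> R -> C) (lam : R) (v1 : Z -> R) (E om : R) (m : nat -> R) (x y : R) :
  (forall k, 2 <= m k) -> (forall k, m k <= Cmod (diag V lam v1 E om k x y)) ->
  forall N, Cmod (bot V lam v1 E om N x y) <= Cmod (top V lam v1 E om N x y) /\
    0 < Cmod (top V lam v1 E om N x y) /\
    lnsum (fun k => ln (m k / 2)) N <= ln (Cmod (top V lam v1 E om N x y)).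
Proof.
  intros Hm HD. induction N as [|N [IH1 [IH2 IH3]]].
  - unfold top, bot; simpl. rewrite Cmod_0, Cmod_1, ln_1. repeat split; lra.
  - specialize (Hm (S N)). specialize (HD (S N)).
    assert (G : m (S N) / 2 * Cmod (top V lam v1 E om N x y) <= Cmod (top V lam v1 E om (S N) x y)).
    { change (top V lam v1 E om (S N) x y) with
        (diag V lam v1 E om (S N) x y * top V lam v1 E om N x y
         + - RtoC 1 * bot V lam v1 E om N x y)%C.
      pose proof (Cmod_lower (bot V lam v1 E om N x y)
        (diag V lam v1 E om (S N) x y * top V lam v1 E om N x y)%C) as T.
      rewrite Cmod_mult, <- (Cmod_opp (bot V lam v1 E om N x y
        - diag V lam v1 E om (S N) x y * top V lam v1 E om N x y)%C) in T.
      replace (- (bot V lam v1 E om N x y - diag V lam v1 E om (S N) x y * top V lam v1 E om N x y))%C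
        with (diag V lam v1 E om (S N) x y * top V lam v1 E om N x y
         + - RtoC 1 * bot V lam v1 E om N x y)%C in T by ring.
      nra. }
    change (bot V lam v1 E om (S N) x y) with (top V lam v1 E om N x y).
    split; [|split].
    + nra.
    + nra.
    + simpl lnsum. eapply Rle_trans; [|apply ln_le; [|exact G]].
      * rewrite ln_mult by lra. lra.
      * apply Rmult_lt_0_compat; lra.
Qed.

(** In the sum norm a step expands by at most [|diag| + 1]. *)
Lemma col_upper (V : R -> R -> C) (lam : R) (v1 : Z -> R) (E om : R) (m : nat -> R) (x y : R) :
  (forall k, Cmod (diag V lam v1 E om k x y) + 1 <= m k) ->
  forall N, ln (Cmod (top V lam v1 E om N x y) + Cmod (bot V lam v1 E om N x y))
     <= lnsum (fun k => ln (m k)) N /\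
    0 < Cmod (top V lam v1 E om N x y) + Cmod (bot V lam v1 E om N x y).
Proof.
  intros HD. induction N as [|N [IH1 IH2]].
  - unfold top, bot; simpl. rewrite Cmod_0, Cmod_1, Rplus_0_r, ln_1. split; lra.
  - specialize (HD (S N)).
    assert (P : 0 < Cmod (top V lam v1 E om (S N) x y) + Cmod (bot V lam v1 E om (S N) x y)).
    { pose proof (col_nonzero V lam v1 E om (S N) x y) as Q. rewrite normsq_Cmod in Q.
      pose proof (Cmod_ge_0 (top V lam v1 E om (S N) x y)).
      pose proof (Cmod_ge_0 (bot V lam v1 E om (S N) x y)). nra. }
    split; auto.
    assert (G : Cmod (top V lam v1 E om (S N) x y) + Cmod (bot V lam v1 E om (S N) x y)
       <= m (S N) * (Cmod (top V lam v1 E om N x y) + Cmod (bot V lam v1 E om N x y))).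
    { change (bot V lam v1 E om (S N) x y) with (top V lam v1 E om N x y).
      change (top V lam v1 E om (S N) x y) with
        (diag V lam v1 E om (S N) x y * top V lam v1 E om N x y
         + - RtoC 1 * bot V lam v1 E om N x y)%C.
      pose proof (Cmod_triangle (diag V lam v1 E om (S N) x y * top V lam v1 E om N x y)%C
         (- RtoC 1 * bot V lam v1 E om N x y)%C) as T.
      rewrite !Cmod_mult, Cmod_m1 in T.
      pose proof (Cmod_ge_0 (top V lam v1 E om N x y)).
      pose proof (Cmod_ge_0 (bot V lam v1 E om N x y)).
      pose proof (Cmod_ge_0 (diag V lam v1 E om (S N) x y)). nra. }
    pose proof (Cmod_ge_0 (diag V lam v1 E om (S N) x y)).
    simpl lnsum. eapply Rle_trans; [apply ln_le; [exact P | exact G]|].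
    rewrite ln_mult; lra.
Qed.

(** * The operator norm *)

(** The length of [A u] as a complex modulus, which gives access to the triangle inequality of
    [Cmod]. *)
Definition apply_norm (A : mat2) (u1 u2 : R) : R :=
  Cmod ((fst (fst A) * u1 + snd (fst A) * u2)%R, (fst (snd A) * u1 + snd (snd A) * u2)%R).

Definition entry_sum (A : mat2) : R :=
  Rabs (fst (fst A)) + Rabs (snd (fst A)) + Rabs (fst (snd A)) + Rabs (snd (snd A)).

Lemma apply_norm_le (A : mat2) (u1 u2 : R) : u1 ^ 2 + u2 ^ 2 = 1 ->
  apply_norm A u1 u2 <= entry_sum A.
Proof.
  intro H. unfold apply_norm, entry_sum.
  assert (B1 : Rabs u1 <= 1) by (apply Rabs_le; nra).
  assert (B2 : Rabs u2 <= 1) by (apply Rabs_le; nra).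
  assert (M : forall t u, Rabs u <= 1 -> Rabs (t * u) <= Rabs t).
  { intros t u Hu. rewrite Rabs_mult. pose proof (Rabs_pos t). nra. }
  eapply Rle_trans; [apply Cmod_le_abs|].
  eapply Rle_trans; [apply Rplus_le_compat; apply Rabs_triang|].
  pose proof (M (fst (fst A)) u1 B1). pose proof (M (snd (fst A)) u2 B2).
  pose proof (M (fst (snd A)) u1 B1). pose proof (M (snd (snd A)) u2 B2). lra.
Qed.

(** [real] sends infinite values to 0, so the supremum must first be shown finite: [entry_sum]
    bounds it above and the vector [(1, 0)] below. *)
Lemma opnorm_spec (A : mat2) :
  (forall u1 u2, u1 ^ 2 + u2 ^ 2 = 1 -> apply_norm A u1 u2 <= opnorm A) /\
  (forall M, (forall u1 u2, u1 ^ 2 + u2 ^ 2 = 1 -> apply_norm A u1 u2 <= M) -> opnorm A <= M).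
Proof.
  pose proof (apply_norm_le A) as Bd.
  destruct A as [[a b] [c d]]. unfold opnorm.
  set (E := fun r => exists u1 u2 : R, u1 ^ 2 + u2 ^ 2 = 1 /\
          r = sqrt ((a * u1 + b * u2) ^ 2 + (c * u1 + d * u2) ^ 2)).
  assert (In : forall u1 u2, u1 ^ 2 + u2 ^ 2 = 1 -> E (apply_norm ((a, b), (c, d)) u1 u2)).
  { intros u1 u2 H. exists u1, u2. split; auto. }
  assert (Out : forall r, E r -> exists u1 u2, u1 ^ 2 + u2 ^ 2 = 1 /\
     r = apply_norm ((a, b), (c, d)) u1 u2).
  { intros r [u1 [u2 [H ->]]]. exists u1, u2. split; auto. }
  destruct (Lub_Rbar_correct E) as [Ub Least].
  set (L := Lub_Rbar E) in *.
  assert (Le : forall M, (forall u1 u2, u1 ^ 2 + u2 ^ 2 = 1 ->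
     apply_norm ((a, b), (c, d)) u1 u2 <= M) -> Rbar_le L M).
  { intros M HM. apply Least. intros r Hr. destruct (Out r Hr) as [u1 [u2 [H ->]]]. apply HM; auto. }
  assert (U1 : 1 ^ 2 + 0 ^ 2 = 1) by ring.
  pose proof (Ub _ (In 1 0 U1)) as Low.
  pose proof (Le _ Bd) as High.
  destruct L as [l| |]; simpl in Low, High; try contradiction. simpl.
  split.
  - intros u1 u2 H. apply (Ub _ (In u1 u2 H)).
  - exact Le.
Qed.

Lemma opnorm_lipschitz (A B : mat2) :
  opnorm A <= opnorm B +
    (Rabs (fst (fst A) - fst (fst B)) + Rabs (snd (fst A) - snd (fst B))
     + Rabs (fst (snd A) - fst (snd B)) + Rabs (snd (snd A) - snd (snd B))).
Proof.
  apply opnorm_spec. intros u1 u2 H.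
  set (D := ((fst (fst A) - fst (fst B), snd (fst A) - snd (fst B)),
             (fst (snd A) - fst (snd B), snd (snd A) - snd (snd B))) : mat2).
  eapply Rle_trans with (apply_norm B u1 u2 + apply_norm D u1 u2).
  - unfold apply_norm. eapply Rle_trans; [|apply Cmod_triangle]. right. f_equal.
    unfold Cplus, D; simpl. f_equal; ring.
  - pose proof (proj1 (opnorm_spec B) u1 u2 H). pose proof (apply_norm_le D u1 u2 H).
    unfold entry_sum, D in *; simpl in *. lra.
Qed.

(** Serves the integrability of [ln (opnorm ...)], without which [RInt] cannot be compared. *)
Lemma opnorm_continuous (A : R -> mat2) (x : R) :
  continuous (fun t => fst (fst (A t))) x -> continuous (fun t => snd (fst (A t))) x ->
  continuous (fun t => fst (snd (A t))) x -> continuous (fun t => snd (snd (A t))) x ->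
  continuous (fun t => opnorm (A t)) x.
Proof.
  intros H1 H2 H3 H4. apply filterlim_locally. intro eps.
  pose proof (cond_pos eps) as Pe. assert (P4 : 0 < eps / 4) by lra.
  pose proof (proj1 (filterlim_locally _ _) H1 (mkposreal _ P4)) as L1.
  pose proof (proj1 (filterlim_locally _ _) H2 (mkposreal _ P4)) as L2.
  pose proof (proj1 (filterlim_locally _ _) H3 (mkposreal _ P4)) as L3.
  pose proof (proj1 (filterlim_locally _ _) H4 (mkposreal _ P4)) as L4.
  pose proof (filter_and _ _ (filter_and _ _ L1 L2) (filter_and _ _ L3 L4)) as L.
  revert L. apply filter_imp. intros t [[B1 B2] [B3 B4]].
  change (Rabs (fst (fst (A t)) - fst (fst (A x))) < eps / 4) in B1.
  change (Rabs (snd (fst (A t)) - snd (fst (A x))) < eps / 4) in B2.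
  change (Rabs (fst (snd (A t)) - fst (snd (A x))) < eps / 4) in B3.
  change (Rabs (snd (snd (A t)) - snd (snd (A x))) < eps / 4) in B4.
  change (Rabs (opnorm (A t) - opnorm (A x)) < eps).
  pose proof (opnorm_lipschitz (A t) (A x)) as T1.
  pose proof (opnorm_lipschitz (A x) (A t)) as T2.
  rewrite (Rabs_minus_sym (fst (fst (A x)))), (Rabs_minus_sym (snd (fst (A x)))),
    (Rabs_minus_sym (fst (snd (A x)))), (Rabs_minus_sym (snd (snd (A x)))) in T2.
  apply Rabs_def1; lra.
Qed.

Lemma transfer_S (v : R -> R) (lam : R) (v1 : Z -> R) (E x om : R) (N : nat) :
  let T := transfer v lam v1 E x om N in
  let s := E - lam * v (x + INR (S N) * om) - v1 (Z.of_nat (S N)) in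
  transfer v lam v1 E x om (S N) =
  ((s * fst (fst T) + - 1 * fst (snd T), s * snd (fst T) + - 1 * snd (snd T)),
   (1 * fst (fst T) + 0 * fst (snd T), 1 * snd (fst T) + 0 * snd (snd T))).
Proof.
  intros T s. change (transfer v lam v1 E x om (S N)) with
    (mmul (step v lam v1 E x om (S N)) T).
  destruct T as [[a b] [c d]]. reflexivity.
Qed.

Lemma transfer_continuous (v : R -> R) (lam : R) (v1 : Z -> R) (E om : R) (N : nat) (x : R) :
  (forall x, continuous v x) ->
  continuous (fun t => fst (fst (transfer v lam v1 E t om N))) x /\
  continuous (fun t => snd (fst (transfer v lam v1 E t om N))) x /\
  continuous (fun t => fst (snd (transfer v lam v1 E t om N))) x /\
  continuous (fun t => snd (snd (transfer v lam v1 E t om N))) x.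
Proof.
  intro Hv.
  assert (Cp : forall f g : R -> R, continuous f x -> continuous g x ->
     continuous (fun t => f t + g t) x).
  { intros f g Hf Hg. exact (continuous_plus (V := R_NormedModule) f g x Hf Hg). }
  assert (Cm : forall f g : R -> R, continuous f x -> continuous g x ->
     continuous (fun t => f t * g t) x).
  { intros f g Hf Hg. exact (continuous_mult (K := R_AbsRing) f g x Hf Hg). }
  induction N as [|N [IH1 [IH2 [IH3 IH4]]]].
  - repeat split; apply continuous_const.
  - assert (Cs : continuous (fun t => E - lam * v (t + INR (S N) * om) - v1 (Z.of_nat (S N))) x).
    { apply (Cp (fun t => E - lam * v (t + INR (S N) * om)) (fun _ => - v1 (Z.of_nat (S N))));
        [|apply continuous_const].
      apply (continuous_minus (V := R_NormedModule) (fun _ => E)); [apply continuous_const|].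
      apply Cm; [apply continuous_const|].
      apply (continuous_comp (fun t => t + INR (S N) * om) v); [|apply Hv].
      apply Cp; [apply continuous_id | apply continuous_const]. }
    repeat split; (eapply continuous_ext; [intro t; rewrite transfer_S; reflexivity|]);
      cbn [fst snd]; apply Cp; apply Cm; auto; apply continuous_const.
Qed.

Lemma col_real (v : R -> R) (V : R -> R -> C) (lam : R) (v1 : Z -> R) (E om : R) (N : nat) (x : R) :
  (forall x, V x 0 = RtoC (v x)) ->
  col V lam v1 E om N x 0 =
    (RtoC (fst (fst (transfer v lam v1 E x om N))), RtoC (fst (snd (transfer v lam v1 E x om N)))).
Proof.
  intro HV. induction N as [|N IH]; [reflexivity|].
  simpl col. rewrite IH, transfer_S. cbn [fst snd]. unfold diag. rewrite HV.
  f_equal; unfold RtoC, Cplus, Cmult, Copp; simpl; f_equal; ring.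
Qed.

(** The first column is the image of the unit vector [(1, 0)], and the half turns the logarithm of
    its squared length into that of its length. *)
Lemma opnorm_ge_col (v : R -> R) (V : R -> R -> C) (lam : R) (v1 : Z -> R) (E om : R) (N : nat) (x : R) :
  (forall x, V x 0 = RtoC (v x)) ->
  0 < opnorm (transfer v lam v1 E x om N) /\
  ln (normsq (top V lam v1 E om N) (bot V lam v1 E om N) x 0) / 2
    <= ln (opnorm (transfer v lam v1 E x om N)).
Proof.
  intro HV. pose proof (col_nonzero V lam v1 E om N x 0) as P.
  set (A := transfer v lam v1 E x om N).
  assert (Eq : apply_norm A 1 0 ^ 2 = normsq (top V lam v1 E om N) (bot V lam v1 E om N) x 0).
  { unfold apply_norm, normsq, top, bot. rewrite (col_real v V lam v1 E om N x HV).
    rewrite Cmod2_alt. fold A. simpl. ring. }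
  pose proof (proj1 (opnorm_spec A) 1 0 ltac:(ring)) as L.
  pose proof (Cmod_ge_0 ((fst (fst A) * 1 + snd (fst A) * 0)%R,
     (fst (snd A) * 1 + snd (snd A) * 0)%R)) as Q. fold (apply_norm A 1 0) in Q.
  rewrite <- Eq in *.
  assert (Q' : 0 < apply_norm A 1 0) by nra.
  split; [lra|].
  replace (ln (apply_norm A 1 0 ^ 2) / 2) with (ln (apply_norm A 1 0)).
  - apply ln_le; assumption.
  - simpl pow. rewrite Rmult_1_r, ln_mult by assumption. lra.
Qed.

(** * The uniform lower bound *)

Lemma lnsum_scal (g h : nat -> R) (c : R) (N : nat) :
  (forall k, h k = g k + c) -> lnsum h N = lnsum g N + INR N * c.
Proof.
  intro H. induction N as [|N IH]; [simpl; ring|]. rewrite S_INR. simpl. rewrite IH, H. ring.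
Qed.

Lemma diag_factor (V : R -> R -> C) (lam : R) (v1 : Z -> R) (E om : R) (k : nat) (x y : R) :
  0 < lam -> Cmod (diag V lam v1 E om k x y)
    = lam * Cmod (V (x + INR k * om)%R y - RtoC ((E - v1 (Z.of_nat k)) / lam))%C.
Proof.
  intro Hl. unfold diag.
  replace (RtoC (E - v1 (Z.of_nat k))) with (RtoC lam * RtoC ((E - v1 (Z.of_nat k)) / lam))%C.
  - rewrite <- (Rabs_pos_eq lam (Rlt_le _ _ Hl)) at 4.
    rewrite <- Cmod_R, <- Cmod_mult, <- Cmod_opp. f_equal. ring.
  - rewrite <- RtoC_mult. f_equal. field. lra.
Qed.

Lemma mean_bounds (F : R -> R) (m : R) : (forall x, continuous F x) ->
  ((forall x, m <= F x) -> m <= RInt F 0 1) /\ ((forall x, F x <= m) -> RInt F 0 1 <= m).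
Proof.
  intro HF.
  assert (Ex : ex_RInt F 0 1).
  { apply (ex_RInt_continuous (V := R_CompleteNormedModule)). intros; apply HF. }
  assert (Ec : ex_RInt (fun _ => m) 0 1) by apply (ex_RInt_const (V := R_NormedModule)).
  assert (Em : RInt (fun _ => m) 0 1 = m).
  { rewrite RInt_const. unfold scal; simpl. unfold mult; simpl. ring. }
  split; intro H; rewrite <- Em; apply RInt_le; auto; lra.
Qed.

Lemma real_analytic_continuous (v : R -> R) :
  (forall x, cont2 (ext v) x 0) -> forall x, continuous v x.
Proof.
  intros H x. apply (continuous_ext (fun t => Re (ext v t 0))).
  - intro t. rewrite ext_real. reflexivity.
  - apply (continuity_2d_pt_slice (fun u w => Re (ext v u w))). apply H.
Qed.

Lemma mean_log_lower (v : R -> R) (d B c a b lam om E : R) (v1 : Z -> R) (N : nat) :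
  (forall x y, Rabs y < d -> holo_at (ext v) (ext1 v) (ext2 v) x y) ->
  (forall x y, Rabs y < d -> Cmod (ext v x y) <= B) -> 0 <= B ->
  one_periodic v -> 0 < c -> 0 < a -> 2 * a <= b -> b < d -> 1 <= lam -> 2 <= lam * c ->
  (forall k x, c * (1 + Rabs ((E - v1 (Z.of_nat k)) / lam))
     <= Cmod (ext v x a - RtoC ((E - v1 (Z.of_nat k)) / lam))%C) ->
  INR N * (ln lam - (2 * Rabs (ln (c / 2)) + ln (B + 2))) <=
  RInt (fun x => ln (normsq (top (ext v) lam v1 E om N) (bot (ext v) lam v1 E om N) x 0) / 2) 0 1.
Proof.
  intros Hh HB B0 Hp Hc Ha Hab Hb Hl Hlc Hgap.
  set (V := ext v) in *.
  set (t := top V lam v1 E om N). set (u := bot V lam v1 E om N).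
  set (w := fun k => (E - v1 (Z.of_nat k)) / lam).
  (* The unbounded part shared by the lower estimate at [a] and the upper one at [b]; it is kept
     exact until the two are combined. *)
  set (g := fun k => ln (lam * (1 + Rabs (w k)))).
  assert (Hper : forall x y, V (x + 1) y = V x y) by (intros; apply (ext_shift v Hp 1%Z)).
  assert (HV : holo d V) by (exists (ext1 v), (ext2 v); exact Hh).
  destruct (holo_col V lam v1 E om d N HV) as [[t1 [t2 Ht]] [u1 [u2 Hu]]].
  fold t in Ht. fold u in Hu.
  assert (Hpos : forall x y, 0 < normsq t u x y) by (intros; apply col_nonzero).
  assert (Hcv := mean_log_convex t t1 t2 u u1 u2 d a b Ht Hu (fun x y _ => Hpos x y)).
  assert (Pt : forall x y, t (x + 1) y = t x y).
  { intros. unfold t, top. rewrite col_periodic by assumption. reflexivity. }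
  assert (Pu : forall x y, u (x + 1) y = u x y).
  { intros. unfold u, bot. rewrite col_periodic by assumption. reflexivity. }
  specialize (Hcv Pt Pu ltac:(lra) Hb).
  assert (Cont : forall y, Rabs y < d -> forall x, continuous (fun x => ln (normsq t u x y)) x).
  { intros y Hy x. apply (continuous_comp (fun x => normsq t u x y) ln).
    - apply continuity_2d_pt_slice. apply cont_normsq; [apply (Ht x y Hy) | apply (Hu x y Hy)].
    - apply (ex_derive_continuous (V := R_NormedModule)). exists (/ normsq t u x y).
      apply is_derive_ln. apply Hpos. }
  assert (Ya : Rabs a < d) by (apply Rabs_def1; lra).
  assert (Yb : Rabs b < d) by (apply Rabs_def1; lra).
  assert (Y0 : Rabs 0 < d) by (rewrite Rabs_R0; lra).
  assert (w1 : forall k, 1 <= 1 + Rabs (w k)) by (intro k; pose proof (Rabs_pos (w k)); lra).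
  assert (Low : 2 * (lnsum g N + INR N * ln (c / 2)) <= RInt (fun x => ln (normsq t u x a)) 0 1).
  { apply mean_bounds; [auto|]. intro x.
    destruct (top_growth V lam v1 E om (fun k => lam * c * (1 + Rabs (w k))) x a) with (N := N)
      as [_ [P G]].
    - intro k. specialize (w1 k). nra.
    - intro k. rewrite diag_factor by lra. rewrite Rmult_assoc.
      apply Rmult_le_compat_l; [lra|]. apply Hgap.
    - rewrite (lnsum_scal g _ (ln (c / 2))) in G.
      + fold t in P, G. eapply Rle_trans; [apply Rmult_le_compat_l; [lra | exact G]|].
        replace (2 * ln (Cmod (t x a))) with (ln (Cmod (t x a) ^ 2))
          by (simpl pow; rewrite Rmult_1_r, ln_mult by assumption; ring).
        apply ln_le; [nra|]. rewrite normsq_Cmod. pose proof (pow2_ge_0 (Cmod (u x a))). lra.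
      + intro k. unfold g. specialize (w1 k). rewrite <- ln_mult; [f_equal; field | nra | lra]. }
  assert (Up : RInt (fun x => ln (normsq t u x b)) 0 1 <= 2 * (lnsum g N + INR N * ln (B + 2))).
  { apply mean_bounds; [auto|]. intro x.
    destruct (col_upper V lam v1 E om (fun k => lam * (1 + Rabs (w k)) * (B + 2)) x b) with (N := N)
      as [G P].
    - intro k. rewrite diag_factor by lra. fold (w k).
      assert (T : Cmod (V (x + INR k * om)%R b - RtoC (w k))%C <= B + Rabs (w k)).
      { unfold Cminus. eapply Rle_trans; [apply Cmod_triangle|]. rewrite Cmod_opp, Cmod_R.
        specialize (HB (x + INR k * om) b Yb). lra. }
      pose proof (Rabs_pos (w k)).
      assert (0 <= Rabs (w k) * B) by (apply Rmult_le_pos; lra).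
      (* The additive 1 of [col_upper] is absorbed through [1 <= lam]. *)
      apply Rle_trans with (lam * (B + Rabs (w k)) + lam * 1).
      + apply Rplus_le_compat; [apply Rmult_le_compat_l; lra | lra].
      + replace (lam * (1 + Rabs (w k)) * (B + 2)) with
          (lam * (B + Rabs (w k)) + lam * (2 + Rabs (w k) * B + Rabs (w k))) by ring.
        apply Rplus_le_compat_l, Rmult_le_compat_l; lra.
    - rewrite (lnsum_scal g _ (ln (B + 2))) in G.
      + fold t in P, G. fold u in P, G.
        eapply Rle_trans; [|apply Rmult_le_compat_l; [lra | exact G]].
        replace (2 * ln (Cmod (t x b) + Cmod (u x b))) with (ln ((Cmod (t x b) + Cmod (u x b)) ^ 2))
          by (simpl pow; rewrite Rmult_1_r, ln_mult by assumption; ring).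
        apply ln_le; [apply Hpos|]. rewrite normsq_Cmod.
        pose proof (Cmod_ge_0 (t x b)). pose proof (Cmod_ge_0 (u x b)). nra.
      + intro k. unfold g. specialize (w1 k). rewrite <- ln_mult; [reflexivity | nra | lra]. }
  assert (Gl : INR N * ln lam <= lnsum g N).
  { apply lnsum_ge. intro k. unfold g. apply ln_le; [lra|]. specialize (w1 k). nra. }
  assert (E2 : RInt (fun x => ln (normsq t u x 0) / 2) 0 1
     = RInt (fun x => ln (normsq t u x 0)) 0 1 / 2).
  { unfold Rdiv. rewrite Rmult_comm, <- (RInt_scal (V := R_CompleteNormedModule)).
    - apply RInt_ext. intros x _. unfold scal; simpl. unfold mult; simpl. ring.
    - apply (ex_RInt_continuous (V := R_CompleteNormedModule)). intros; apply Cont; assumption. }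
  rewrite E2.
  set (I0 := RInt (fun x => ln (normsq t u x 0)) 0 1) in *.
  set (Ia := RInt (fun x => ln (normsq t u x a)) 0 1) in *.
  set (Ib := RInt (fun x => ln (normsq t u x b)) 0 1) in *.
  set (L1 := Rabs (ln (c / 2))) in *. set (L2 := ln (B + 2)) in *.
  assert (HL1 : - L1 <= ln (c / 2)).
  { unfold L1. pose proof (Rle_abs (- ln (c / 2))) as Q. rewrite Rabs_Ropp in Q. lra. }
  assert (HL1' : 0 <= L1) by apply Rabs_pos.
  assert (HL2 : 0 <= L2) by (unfold L2; rewrite <- ln_1; apply ln_le; lra).
  pose proof (pos_INR N) as HN.
  assert (HN1 : - (INR N * L1) <= INR N * ln (c / 2)).
  { replace (- (INR N * L1)) with (INR N * (- L1)) by ring. apply Rmult_le_compat_l; assumption. }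
  assert (Q1 : 0 <= INR N * L1) by (apply Rmult_le_pos; assumption).
  assert (Q2 : 0 <= INR N * L2) by (apply Rmult_le_pos; assumption).
  (* Because [2 * a <= b], the error weights satisfy [b <= 2 (b - a)] for [L1] and [a <= b - a] for
     [L2]: hence [2 * L1 + L2] in the final constant. *)
  assert (K : (b - a) * (2 * (lnsum g N - (2 * (INR N * L1) + INR N * L2))) <= (b - a) * I0).
  { apply Rle_trans with (b * Ia - a * Ib); [|lra].
    assert (K1 : b * (2 * (lnsum g N - INR N * L1)) <= b * Ia) by (apply Rmult_le_compat_l; lra).
    assert (K2 : a * Ib <= a * (2 * (lnsum g N + INR N * L2))) by (apply Rmult_le_compat_l; lra).
    assert (K3 : 0 <= (b - 2 * a) * (INR N * L1)) by (apply Rmult_le_pos; lra).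
    assert (K4 : 0 <= (b - 2 * a) * (INR N * L2)) by (apply Rmult_le_pos; lra).
    lra. }
  apply Rmult_le_reg_l in K; lra.
Qed.

Theorem theorem1 (v : R -> R) :
  real_analytic v -> one_periodic v -> non_constant v ->
  forall q : nat,
  exists lam0 C : R, 0 < lam0 /\
    forall (lam om : R) (v1 : Z -> R) (E : R),
      lam0 < lam -> at_most_q_values q v1 ->
      Rbar_le (Finite (ln lam - C)) (lowerLyap v lam v1 om E).
Proof.
  intros Hv Hp Hn q.
  destruct (strip_exists v Hv Hp Hn) as [d [B [Hd [HB [Hs Hlev]]]]].
  assert (HV : strip_function (ext v) d B).
  { split.
    - apply ext_shift. exact Hp.
    - intros x y Hy. apply (Hs x y Hy).
    - intros x y Hy. apply (Hs x y Hy).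
    - exact Hlev. }
  set (e := d / 2).
  (* Bands of height [e / 4] starting at [e / 4] will place [a] between [e / 4] and [e / 2]: away
     from the real axis, and with [2 * a <= e], the upper line. *)
  destruct (gap_list (ext v) d B e q HV HB ltac:(unfold e; lra) (e / 4) ltac:(unfold e; lra))
    as [c [Hc Hgap]].
  assert (Hvc : forall x, continuous v x).
  { apply real_analytic_continuous. intro x. apply (strip_cont _ _ _ HV). rewrite Rabs_R0; exact Hd. }
  assert (P2c : 0 < 2 / c) by (apply Rdiv_lt_0_compat; lra).
  (* This threshold ensures both [1 <= lam] and [2 <= lam * c], the latter for the invariant
     cone. *)
  exists (1 + 2 / c), (2 * Rabs (ln (c / 2)) + ln (B + 2)). split; [lra|].
  intros lam om v1 E Hlam [l [Hl Hin]].
  assert (Hlc : 2 <= lam * c).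
  { apply Rle_trans with (2 / c * c); [right; field; lra|]. apply Rmult_le_compat_r; lra. }
  (* Only now do [E], [lam] and the background enter: they select the line [a], after [c] has been
     fixed. *)
  destruct (Hgap (e / 4) ltac:(unfold e; lra) ltac:(unfold e; lra)
     (map (fun s => (E - s) / lam) l)) as [a [A1 [A2 A3]]].
  { rewrite length_map. exact Hl. }
  unfold lowerLyap.
  rewrite <- (LimInf_seq_const (ln lam - (2 * Rabs (ln (c / 2)) + ln (B + 2)))).
  (* The bound holds at every scale [S n], not only in the limit. *)
  apply LimInf_le. exists O. intros n _. unfold LN.
  assert (Pn : 0 < INR (S n)) by (apply lt_0_INR; lia).
  apply Rmult_le_reg_l with (INR (S n)); [exact Pn|].
  rewrite <- Rmult_assoc, Rinv_r, Rmult_1_l by lra.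
  eapply Rle_trans.
  - apply (mean_log_lower v d B c a e lam om E v1 (S n)); auto; try (unfold e in *; lra).
    + intros x y Hy. apply (Hs x y Hy).
    + intros x y Hy. apply (Hs x y Hy).
    + intros k x. apply A3; [|lra]. apply (in_map (fun s => (E - s) / lam)). apply Hin.
  - assert (Hr : forall x, ext v x 0 = RtoC (v x)) by apply ext_real.
    apply RInt_le; [lra| | |].
    + destruct (holo_col (ext v) lam v1 E om d (S n)) as [[t1 [t2 Ht]] [u1 [u2 Hu]]].
      { exists (ext1 v), (ext2 v). intros x y Hy. apply (Hs x y Hy). }
      assert (Y0 : Rabs 0 < d) by (rewrite Rabs_R0; lra).
      apply (ex_RInt_continuous (V := R_CompleteNormedModule)). intros x _.
      apply (continuous_mult (K := R_AbsRing)
        (fun x => ln (normsq (top (ext v) lam v1 E om (S n)) (bot (ext v) lam v1 E om (S n)) x 0)));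
        [|apply continuous_const].
      apply (continuous_comp (fun x => normsq _ _ x 0) ln).
      * apply continuity_2d_pt_slice. apply cont_normsq; [apply (Ht x 0 Y0) | apply (Hu x 0 Y0)].
      * apply (ex_derive_continuous (V := R_NormedModule)). eexists.
        apply is_derive_ln. apply col_nonzero.
    + apply (ex_RInt_continuous (V := R_CompleteNormedModule)). intros x _.
      apply (continuous_comp (fun x => opnorm (transfer v lam v1 E x om (S n))) ln).
      * apply opnorm_continuous; apply (transfer_continuous v lam v1 E om (S n) x Hvc).
      * apply (ex_derive_continuous (V := R_NormedModule)). eexists.
        apply is_derive_ln. apply (opnorm_ge_col v (ext v)). exact Hr.
    + intros x _. apply (opnorm_ge_col v (ext v)). exact Hr.
Qed.
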